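(* As formal power series in commuting indeterminates $x,y$ with coefficients in $\mathrm{End}_K(\mathbf F)$, \[ U(x)D(y)\prod_{i=0}^{n-1}\frac{1}{1-q^{2i}xy} = D(y)U(x). \]
   Context: Fix an integer $n\ge 1$. Partitions are drawn in English notation; the box in row $r$ and column $c$ lies on diagonal $c-r$. An $n$-ribbon is a connected skew shape with $n$ boxes containing no $2\times 2$ square; its head is its top-right box, and its spin is its number of rows minus $1$. Let $K=\mathbb{C}(q)$ and let $\mathbf F$ be the $K$-vector space with basis the set of all partitions. For $i\in\mathbb{Z}$, $u_i\in\mathrm{End}_K(\mathbf F)$ is defined by $u_i(\lambda)=q^{\mathrm{spin}(\mu/\lambda)}\mu$ if $\mu/\lambda$ is an $n$-ribbon with head on diagonal $i$ for some partition $\mu$, and $u_i(\lambda)=0$ otherwise; $d_i(\lambda)=q^{\mathrm{spin}(\lambda/\nu)}\nu$ if $\lambda/\nu$ is an $n$-ribbon with head on diagonal $i$ for some partition $\nu$, and $d_i(\lambda)=0$ otherwise. Define \[U(x)=\cdots(1+xu_2)(1+xu_1)(1+xu_0)(1+xu_{-1})\cdots,\qquad D(x)=\cdots(1+xd_{-2})(1+xd_{-1})(1+xd_0)(1+xd_1)\cdots,\] i.e. in $U$ factors with larger index stand to the left, and in $D$ factors with smaller index stand to the left. Each coefficient of these products acts on any given partition through finitely many nonzero terms, so they are well-defined power series of operators. *)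

(* Defs.v *)
From HB Require Import structures.
From mathcomp Require Import all_boot all_order all_algebra.
From mathcomp Require Import zify boolp reals complex freeg.

Set Implicit Arguments.
Unset Strict Implicit.
Unset Printing Implicit Defensive.

Import Order.TTheory GRing.Theory Num.Theory.
Local Open Scope ring_scope.

Definition Cq (R : realType) : fieldType := {fraction {poly R[i]}}.
Definition qvar (R : realType) : Cq R := tofrac ('X : {poly R[i]}).

(* -------------------------------------------------------------------------- *)
(* The product of the ring endo V is composition: (f * g) v = f (g v).         *)

Section Endomorphisms.
Variables (K : fieldType) (V : lmodType K).

Record endo := Endo { endo_fun :> V -> V; endo_linear : linear endo_fun }.

HB.instance Definition _ (f : endo) :=
  GRing.isLinear.Build K V V _ (endo_fun f) (endo_linear f).

HB.instance Definition _ := gen_eqMixin endo.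
HB.instance Definition _ := gen_choiceMixin endo.

Lemma endoP (f g : endo) : endo_fun f =1 endo_fun g -> f = g.
Proof.
case: f g => [f fl] [g gl] /= /funext fg.
by case: _ / fg gl => gl; congr Endo; apply: Prop_irrelevance.
Qed.

Fact endo_zero_linear : linear (fun _ : V => 0 : V).
Proof. by move=> c v w; rewrite scaler0 addr0. Qed.
Definition endo_zero := Endo endo_zero_linear.

Fact endo_opp_linear (f : endo) : linear (fun v => - f v).
Proof. by move=> c v w; rewrite linearP opprD scalerN. Qed.
Definition endo_opp f := Endo (endo_opp_linear f).

Fact endo_add_linear (f g : endo) : linear (fun v => f v + g v).
Proof. by move=> c v w; rewrite !linearP scalerDr addrACA. Qed.
Definition endo_add f g := Endo (endo_add_linear f g).

Fact endo_one_linear : linear (fun v : V => v).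
Proof. by []. Qed.
Definition endo_one := Endo endo_one_linear.

Fact endo_mul_linear (f g : endo) : linear (fun v => f (g v)).
Proof. by move=> c v w; rewrite !linearP. Qed.
Definition endo_mul f g := Endo (endo_mul_linear f g).

Fact endo_scale_linear (c : K) : linear (fun v : V => c *: v).
Proof. by move=> d v w; rewrite scalerDr !scalerA mulrC. Qed.
Definition endo_scale c := Endo (endo_scale_linear c).

Fact endo_addA : associative endo_add.
Proof. by move=> f g h; apply: endoP => v /=; rewrite addrA. Qed.
Fact endo_addC : commutative endo_add.
Proof. by move=> f g; apply: endoP => v /=; rewrite addrC. Qed.
Fact endo_add0 : left_id endo_zero endo_add.
Proof. by move=> f; apply: endoP => v /=; rewrite add0r. Qed.
Fact endo_addN : left_inverse endo_zero endo_opp endo_add.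
Proof. by move=> f; apply: endoP => v /=; rewrite addNr. Qed.

HB.instance Definition _ :=
  GRing.isZmodule.Build endo endo_addA endo_addC endo_add0 endo_addN.

Fact endo_mulA : associative endo_mul.
Proof. by move=> f g h; apply: endoP. Qed.
Fact endo_mul1l : left_id endo_one endo_mul.
Proof. by move=> f; apply: endoP. Qed.
Fact endo_mul1r : right_id endo_one endo_mul.
Proof. by move=> f; apply: endoP. Qed.
Fact endo_mulDl : left_distributive endo_mul endo_add.
Proof. by move=> f g h; apply: endoP. Qed.
Fact endo_mulDr : right_distributive endo_mul endo_add.
Proof. by move=> f g h; apply: endoP => v /=; rewrite linearD. Qed.

HB.instance Definition _ := GRing.Zmodule_isPzRing.Build endo
  endo_mulA endo_mul1l endo_mul1r endo_mulDl endo_mulDr.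

Lemma endo0E v : (0 : endo) v = 0. Proof. by []. Qed.
Lemma endo1E v : (1 : endo) v = v. Proof. by []. Qed.
Lemma endoDE (f g : endo) v : (f + g) v = f v + g v. Proof. by []. Qed.
Lemma endoME (f g : endo) v : (f * g) v = f (g v). Proof. by []. Qed.

End Endomorphisms.

(* -------------------------------------------------------------------------- *)
(* A need not be commutative; the indeterminate fpsX A is central (fpsXC).     *)

Record fps (A : Type) := Fps { fcoef : nat -> A }.

Section FpsType.
Variable A : Type.
HB.instance Definition _ := gen_eqMixin (fps A).
HB.instance Definition _ := gen_choiceMixin (fps A).

Lemma fpsP (s t : fps A) : fcoef s =1 fcoef t -> s = t.
Proof. by case: s t => [s] [t] /= /funext ->. Qed.
End FpsType.

Definition fps_map (A B : Type) (f : A -> B) (s : fps A) : fps B :=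
  Fps (fun k => f (fcoef s k)).

Section FpsRing.
Variable A : pzRingType.
Implicit Types s t : fps A.

Definition fps_zero : fps A := Fps (fun _ => 0).
Definition fps_opp s : fps A := Fps (fun k => - fcoef s k).
Definition fps_add s t : fps A := Fps (fun k => fcoef s k + fcoef t k).

Fact fps_addA : associative fps_add.
Proof. by move=> s t u; apply: fpsP => k /=; rewrite addrA. Qed.
Fact fps_addC : commutative fps_add.
Proof. by move=> s t; apply: fpsP => k /=; rewrite addrC. Qed.
Fact fps_add0 : left_id fps_zero fps_add.
Proof. by move=> s; apply: fpsP => k /=; rewrite add0r. Qed.
Fact fps_addN : left_inverse fps_zero fps_opp fps_add.
Proof. by move=> s; apply: fpsP => k /=; rewrite addNr. Qed.

HB.instance Definition _ :=
  GRing.isZmodule.Build (fps A) fps_addA fps_addC fps_add0 fps_addN.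

Definition fpsC (a : A) : fps A := Fps (fun k => if k == 0%N then a else 0).
Definition fpsX : fps A := Fps (fun k => if k == 1%N then 1 else 0).
Definition fps_mul s t : fps A :=
  Fps (fun k => \sum_(i < k.+1) fcoef s i * fcoef t (k - i)).

Lemma fps_mul_rev s t k :
  \sum_(i < k.+1) fcoef s i * fcoef t (k - i) =
  \sum_(i < k.+1) fcoef s (k - i) * fcoef t i.
Proof.
rewrite (reindex_inj rev_ord_inj) /=.
by apply: eq_bigr => i _; rewrite subSS subKn // leq_ord.
Qed.

Fact fps_mulA : associative fps_mul.
Proof.
move=> p q r; apply: fpsP => i; rewrite [RHS](fps_mul_rev (fps_mul p q) r i).
pose coef3 j k := fcoef p j * (fcoef q (i - j - k) * fcoef r k).
transitivity (\sum_(j < i.+1) \sum_(k < i.+1 | (k <= i - j)%N) coef3 j k).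
  rewrite [LHS]/=; apply: eq_bigr => /= j _.
  rewrite fps_mul_rev big_distrr /=.
  by rewrite (big_ord_narrow_leq (leq_subr _ _)).
rewrite (exchange_big_dep predT) //=; apply: eq_bigr => k _.
transitivity (\sum_(j < i.+1 | (j <= i - k)%N) coef3 j k).
  apply: eq_bigl => j; rewrite -ltnS -(ltnS j) -!subSn ?leq_ord //.
  by rewrite -subn_gt0 -(subn_gt0 j) -!subnDA addnC.
rewrite (big_ord_narrow_leq (leq_subr _ _)) /= big_distrl /=.
by apply: eq_bigr => j _; rewrite /coef3 -!subnDA addnC mulrA.
Qed.

Fact fps_mul1l : left_id (fpsC 1) fps_mul.
Proof.
move=> s; apply: fpsP => k /=; rewrite big_ord_recl subn0 /= mul1r.
by rewrite big1 ?addr0 // => i _; rewrite mul0r.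
Qed.

Fact fps_mul1r : right_id (fpsC 1) fps_mul.
Proof.
move=> s; apply: fpsP => k.
rewrite [LHS](fps_mul_rev s (fpsC 1) k) big_ord_recl subn0 /= mulr1.
by rewrite big1 ?addr0 // => i _; rewrite mulr0.
Qed.

Fact fps_mulDl : left_distributive fps_mul fps_add.
Proof.
move=> s t u; apply: fpsP => k /=; rewrite -big_split /=.
by apply: eq_bigr => i _; rewrite mulrDl.
Qed.

Fact fps_mulDr : right_distributive fps_mul fps_add.
Proof.
move=> s t u; apply: fpsP => k /=; rewrite -big_split /=.
by apply: eq_bigr => i _; rewrite mulrDr.
Qed.

HB.instance Definition _ := GRing.Zmodule_isPzRing.Build (fps A)
  fps_mulA fps_mul1l fps_mul1r fps_mulDl fps_mulDr.

Lemma fcoefD s t k : fcoef (s + t) k = fcoef s k + fcoef t k.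
Proof. by []. Qed.
Lemma fcoefM s t k :
  fcoef (s * t) k = \sum_(i < k.+1) fcoef s i * fcoef t (k - i).
Proof. by []. Qed.
Lemma fcoef1 k : fcoef (1 : fps A) k = if k == 0%N then 1 else 0.
Proof. by []. Qed.

Lemma fcoefXM s k : fcoef (fpsX * s) k = if k is k'.+1 then fcoef s k' else 0.
Proof.
rewrite fcoefM; case: k => [|k]; first by rewrite big_ord1 mul0r.
rewrite !big_ord_recl big1 /= => [|i _]; last by rewrite mul0r.
by rewrite mul0r add0r mul1r addr0 subSS subn0.
Qed.

Lemma fcoefCM a s k : fcoef (fpsC a * s) k = a * fcoef s k.
Proof.
rewrite fcoefM big_ord_recl subn0 big1 ?addr0 // => i _.
by rewrite /= mul0r.
Qed.

Lemma fcoefMC s a k : fcoef (s * fpsC a) k = fcoef s k * a.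
Proof.
rewrite fcoefM fps_mul_rev.
by rewrite big_ord_recl subn0 big1 ?addr0 // => i _; rewrite /= mulr0.
Qed.

Lemma fpsXC s : fpsX * s = s * fpsX.
Proof.
apply: fpsP => k; rewrite fcoefXM fcoefM fps_mul_rev.
case: k => [|k]; first by rewrite big_ord1 mulr0.
rewrite !big_ord_recl big1 /= => [|i _]; last by rewrite mulr0.
by rewrite mulr0 add0r mulr1 addr0 subSS subn0.
Qed.

End FpsRing.

Section FpsNzRing.
Variable A : nzRingType.
Fact fps_oner_neq0 : (1 : fps A) != 0.
Proof.
by apply/eqP => /(congr1 (fun s : fps A => fcoef s 0)) /eqP /=; rewrite oner_eq0.
Qed.
HB.instance Definition _ :=
  GRing.PzSemiRing_isNonZero.Build (fps A) fps_oner_neq0.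
End FpsNzRing.

Section FpsUnitRing.
Variable A : comNzRingType.
Implicit Types s t : fps A.

Fact fps_mulC : commutative (@GRing.mul (fps A)).
Proof.
move=> s t; apply: fpsP => k.
rewrite !fcoefM fps_mul_rev.
by apply: eq_bigr => i _; rewrite mulrC.
Qed.
HB.instance Definition _ :=
  GRing.PzRing_hasCommutativeMul.Build (fps A) fps_mulC.

Definition fps_unit : {pred fps A} := fun s => `[< exists t, t * s = 1 >].
(* s^-1 is the inverse of s when there is one, and s otherwise; see            *)
(* one_sub_cxy_unit for the series inverted below.                             *)
Definition fps_inv s : fps A :=
  if pselect (exists t, t * s = 1) is left e then projT1 (cid e) else s.

Fact fps_mulVx : {in fps_unit, left_inverse 1 fps_inv *%R}.
Proof.
move=> s /asboolP e; rewrite /fps_inv; case: pselect => // e'.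
by case: (cid e').
Qed.
Fact fps_unitPl s t : t * s = 1 -> fps_unit s.
Proof. by move=> e; apply/asboolP; exists t. Qed.
Fact fps_invr_out : {in [predC fps_unit], fps_inv =1 id}.
Proof.
by move=> s /asboolP ns; rewrite /fps_inv; case: pselect.
Qed.
HB.instance Definition _ := GRing.ComNzRing_hasMulInverse.Build (fps A)
  fps_mulVx fps_unitPl fps_invr_out.

Lemma fps_geometric a :
  (1 - fpsC a * fpsX A) * Fps (fun k => a ^+ k) = 1.
Proof.
apply: fpsP => k; rewrite mulrBl mul1r -mulrA.
rewrite -[LHS]/(a ^+ k - fcoef (fpsC a * (fpsX A * Fps (fun k => a ^+ k))) k).
rewrite fcoefCM fcoefXM; case: k => [|k] /=; first by rewrite mulr0 subr0.
by rewrite -exprS subrr.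
Qed.

End FpsUnitRing.

(* -------------------------------------------------------------------------- *)
(* A[[x, y]] is A[[y]][[x]]: the coefficient of x^a y^b in s is                *)
(* fcoef (fcoef s a) b.                                                        *)

Section TwoVariables.
Variable A : pzRingType.
Definition varx : fps (fps A) := fpsX (fps A).
Definition vary : fps (fps A) := fpsC (fpsX A).
Definition in_x (s : fps A) : fps (fps A) := fps_map (@fpsC A) s.
Definition in_y (s : fps A) : fps (fps A) := fpsC s.
Definition const2 (a : A) : fps (fps A) := fpsC (fpsC a).
End TwoVariables.
Arguments varx {A}.
Arguments vary {A}.

Lemma one_sub_cxy_unit (A : comNzRingType) (c : A) :
  1 - const2 c * varx * vary \is a GRing.unit.
Proof.
apply/unitrP; exists (Fps (fun k => (fpsC c * fpsX A) ^+ k)).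
rewrite [_ * (1 - _)]mulrC.
suff -> : const2 c * varx * vary = fpsC (fpsC c * fpsX A) * varx.
  by rewrite fps_geometric.
rewrite mulrAC; congr (_ * _); apply: fpsP => k.
by rewrite fcoefCM /=; case: eqP; rewrite ?mulr0.
Qed.

Definition scalar_fps2 (K : fieldType) (V : lmodType K) :
    fps (fps K) -> fps (fps (endo V)) :=
  fps_map (fps_map (@endo_scale K V)).

(* -------------------------------------------------------------------------- *)
Definition is_partition (s : seq nat) : bool := sorted geq s && (0%N \notin s).

Record partition := Partition { parts :> seq nat; _ : is_partition parts }.
HB.instance Definition _ := [isSub for parts].
HB.instance Definition _ := [Choice of partition by <:].

(* Rows and columns are numbered from 0, rows downwards; a box is a pair       *)
(* (row, column).                                                              *)
Definition box : Type := (nat * nat)%type.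
Definition diagonal (b : box) : int := b.2%:Z - b.1%:Z.

Definition included (la mu : partition) : Prop :=
  forall r, (nth 0%N la r <= nth 0%N mu r)%N.

Definition skew_boxes (la mu : partition) : seq box :=
  [seq (r, c) | r <- iota 0 (size mu),
                c <- iota (nth 0%N la r) (nth 0%N mu r - nth 0%N la r)].

Lemma mem_skew_boxes la mu r c :
  ((r, c) \in skew_boxes la mu) = (nth 0 la r <= c < nth 0 mu r)%N.
Proof.
apply/allpairsPdep/idP => [[r' [c' [_ + [-> ->]]]]|/andP[lec ltc]].
  rewrite mem_iota => /andP[le1]; rewrite le1 /=.
  case: (leqP (nth 0 la r') (nth 0 mu r'))%N => [le2|/ltnW/eqP->].
    by rewrite subnKC.
  by rewrite addn0 ltnNge le1.
exists r, c; split=> //.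
  rewrite mem_iota /= add0n ltnNge; apply: contraTN ltc => /(nth_default 0) ->.
  by rewrite ltn0.
by rewrite mem_iota lec subnKC //; apply: leq_trans (ltnW ltc).
Qed.

Definition adjacent : rel box := fun b b' =>
  ((b.1 == b'.1) && ((b.2 == b'.2.+1) || (b'.2 == b.2.+1))) ||
  ((b.2 == b'.2) && ((b.1 == b'.1.+1) || (b'.1 == b.1.+1))).

Definition connected_boxes (s : seq box) : Prop :=
  forall b b', b \in s -> b' \in s ->
  exists p, [/\ path adjacent b p, {subset p <= s} & last b p = b'].

Definition no_2x2 (s : seq box) : Prop :=
  forall r c, ~~ [&& (r, c) \in s, (r, c.+1) \in s,
                     (r.+1, c) \in s & (r.+1, c.+1) \in s].

Definition ribbon (n : nat) (la mu : partition) : Prop :=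
  [/\ included la mu, size (skew_boxes la mu) = n,
      connected_boxes (skew_boxes la mu) & no_2x2 (skew_boxes la mu)].

Definition is_head (s : seq box) (b : box) : Prop :=
  b \in s /\ forall b', b' \in s -> (b.1 <= b'.1)%N /\ (b'.2 <= b.2)%N.

Definition spin (la mu : partition) : nat :=
  (size (undup [seq b.1 | b <- skew_boxes la mu])).-1.

Definition ribbon_at (n : nat) (i : int) (la mu : partition) : Prop :=
  ribbon n la mu /\
  exists2 b, is_head (skew_boxes la mu) b & diagonal b = i.

(* -------------------------------------------------------------------------- *)
Definition fock (K : fieldType) : lmodType K := {freeg partition / K}.

Section Operators.
Variables (K : fieldType) (q : K) (n : nat).

Definition ket (la : partition) : fock K := << la >>.

Lemma fockE (v : fock K) : v = \sum_(la <- dom v) coeff la v *: ket la.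
Proof.
rewrite -{1}[v]freeg_sumE; apply: eq_bigr => la _.
by apply/eqP/freeg_eqP => mu; rewrite coeffZ !coeffU mul1r.
Qed.

Section Extension.
Variable f : partition -> fock K.

Fact fglift_linear : linear (fglift f : fock K -> fock K).
Proof.
pose g : fock K -> fock K := fglift f.
have gB v w : g (v - w) = g v - g w by exact: lift_is_additive.
have g0 : g 0 = 0 by have := gB 0 0; rewrite !subrr.
have gD v w : g (v + w) = g v + g w.
  by rewrite -{1}[w]opprK gB -[- w]sub0r gB g0 sub0r opprK.
have gU c la : g << c *g la >> = c *: f la by exact: liftU.
move=> c v w; rewrite -/g gD; congr (_ + _).
have gS (I : Type) (r : seq I) F : g (\sum_(i <- r) F i) = \sum_(i <- r) g (F i).
  exact: (big_morph g gD g0).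
rewrite [v]fockE scaler_sumr !gS scaler_sumr; apply: eq_bigr => la _.
rewrite scalerA; have kU d : d *: ket la = << d *g la >>.
  by apply/eqP/freeg_eqP => mu; rewrite coeffZ !coeffU mul1r.
by rewrite !kU !gU scalerA.
Qed.

Definition extend : endo (fock K) := Endo fglift_linear.

Lemma extend_ket la : extend (ket la) = f la.
Proof. by rewrite -[RHS]scale1r; exact: liftU. Qed.

Lemma extendE v : extend v = \sum_(la <- dom v) coeff la v *: f la.
Proof.
rewrite {1}[v]fockE linear_sum; apply: eq_bigr => la _.
by rewrite linearZ; congr (_ *: _); exact: extend_ket.
Qed.
End Extension.

(* The choice of mu (resp. nu) below is immaterial: a partition has at most    *)
(* one addable (resp. removable) n-ribbon with head on a given diagonal.       *)
Definition op_u (i : int) : endo (fock K) := extend (fun la =>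
  if pselect (exists mu, ribbon_at n i la mu) is left e
  then let mu := projT1 (cid e) in q ^+ spin la mu *: ket mu else 0).

Definition op_d (i : int) : endo (fock K) := extend (fun la =>
  if pselect (exists nu, ribbon_at n i nu la) is left e
  then let nu := projT1 (cid e) in q ^+ spin nu la *: ket nu else 0).

Definition window (N : nat) : seq int :=
  [seq j%:Z - N%:Z | j <- iota 0 (N.*2.+1)].

Definition linear_factor (a : int -> endo (fock K)) (i : int) :
    fps (endo (fock K)) := 1 + fpsX _ * fpsC (a i).

(* \prod_(i <- s) puts the factor of the first index of s on the left, and     *)
(* window N is increasing, so larger indices stand to the left in U_part and   *)
(* to the right in D_part.                                                     *)
Definition U_part (N : nat) : fps (endo (fock K)) :=
  \prod_(i <- rev (window N)) linear_factor op_u i.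
Definition D_part (N : nat) : fps (endo (fock K)) :=
  \prod_(i <- window N) linear_factor op_d i.

End Operators.

Section StableLimit.
Variable K : fieldType.

Definition eventually_eq (T : Type) (s : nat -> T) (t : T) : Prop :=
  exists N0, forall N, (N0 <= N)%N -> s N = t.

Lemma eventually_eq_unique (T : Type) (s : nat -> T) t t' :
  eventually_eq s t -> eventually_eq s t' -> t = t'.
Proof.
move=> [N1 h1] [N2 h2].
by rewrite -(h1 _ (leq_maxl N1 N2)) -(h2 _ (leq_maxr N1 N2)).
Qed.

Definition stable_value (s : nat -> fock K) : fock K :=
  if pselect (exists v, eventually_eq s v) is left e then projT1 (cid e) else 0.

Lemma stable_valueP s v : eventually_eq s v -> stable_value s = v.
Proof.
move=> sv; rewrite /stable_value; case: pselect => [e|[]]; last by exists v.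
by apply: eventually_eq_unique sv; case: (cid e).
Qed.

(* The power series of operators each of whose coefficients acts on every      *)
(* partition as the corresponding coefficient of P N does for all large N; the *)
(* lemmas U_series_stable and D_series_stable show that the infinite products  *)
(* are such limits.                                                            *)
Definition stable_limit (P : nat -> fps (endo (fock K))) :
    fps (endo (fock K)) :=
  Fps (fun k => extend (fun la =>
    stable_value (fun N => fcoef (P N) k (ket K la)))).
End StableLimit.

Section InfiniteProducts.
Variables (K : fieldType) (q : K) (n : nat).

Definition U_series : fps (endo (fock K)) := stable_limit (U_part q n).
Definition D_series : fps (endo (fock K)) := stable_limit (D_part q n).

Lemma windowS N :
  window N.+1 = - (N.+1)%:Z :: rcons (window N) N.+1%:Z.
Proof.
rewrite /window doubleS -cat1s -cats1.
rewrite -[N.*2.+3]/(1 + N.*2.+2)%N iotaD map_cat -[N.*2.+2]addn1 iotaD map_cat.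
congr (_ ++ (_ ++ _)).
- by rewrite /= sub0r.
- rewrite (iotaDl 1 0) -map_comp; apply: eq_map => j /=.
  by rewrite PoszD [N.+1%:Z]intS opprD addrACA subrr add0r.
- rewrite /=; congr [:: _].
  by lia.
Qed.

Definition supp_le (m : nat) (v : fock K) : Prop :=
  forall la : partition, la \in dom v -> (sumn la <= m)%N.

Lemma supp_leD m v w : supp_le m v -> supp_le m w -> supp_le m (v + w).
Proof.
move=> hv hw la /domD_subset; rewrite mem_cat => /orP[]; [exact: hv|exact: hw].
Qed.

Lemma supp_leW m m' v : (m <= m')%N -> supp_le m v -> supp_le m' v.
Proof. by move=> le hv la /hv /leq_trans; apply. Qed.

Lemma supp_le0 m : supp_le m 0.
Proof. by move=> la; rewrite dom0. Qed.

Lemma supp_leZ m c v : supp_le m v -> supp_le m (c *: v).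
Proof. by move=> hv la /domZ_subset /hv. Qed.

Lemma supp_le_ket (la : partition) : supp_le (sumn la) (ket K la).
Proof. by move=> mu; rewrite domU1 inE => /eqP ->. Qed.

Lemma supp_le_sum m (I : eqType) (r : seq I) (F : I -> fock K) :
  (forall i, i \in r -> supp_le m (F i)) -> supp_le m (\sum_(i <- r) F i).
Proof.
move=> h; rewrite big_seq; elim/big_ind: _ => //; first exact: supp_le0.
by move=> v w; exact: supp_leD.
Qed.

Definition local_family (a : int -> endo (fock K)) : Prop :=
  (forall i m v, supp_le m v -> supp_le (m + n) (a i v)) /\
  (forall i m v, supp_le m v -> (m + n <= `|i|)%N -> a i v = 0).

Section Stabilization.
Variable a : int -> endo (fock K).
Hypothesis a_loc : local_family a.

Let P (s : seq int) := \prod_(i <- s) linear_factor a i.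

Lemma coef_factorM i Q k v :
  fcoef (linear_factor a i * Q) k v =
  fcoef Q k v + (if k is k'.+1 then a i (fcoef Q k' v) else 0).
Proof.
rewrite mulrDl mul1r fcoefD -mulrA fcoefXM endoDE; congr (_ + _).
by case: k => // k; rewrite fcoefCM.
Qed.

Lemma coef_Mfactor i Q k v :
  fcoef (Q * linear_factor a i) k v =
  fcoef Q k v + (if k is k'.+1 then fcoef Q k' (a i v) else 0).
Proof.
rewrite mulrDr mulr1 fcoefD mulrA -fpsXC -mulrA fcoefXM endoDE; congr (_ + _).
by case: k => // k; rewrite fcoefMC.
Qed.

Lemma supp_le_prod s k m v : supp_le m v -> supp_le (m + k * n) (fcoef (P s) k v).
Proof.
elim: s k => [|i s IHs] k hv; rewrite /P ?big_nil ?big_cons.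
  rewrite fcoef1; case: eqP => _; last exact: supp_le0.
  by apply: supp_leW hv; rewrite leq_addr.
rewrite coef_factorM; apply: supp_leD; first exact: IHs.
case: k => [|k]; first exact: supp_le0.
by rewrite mulSnr addnA; apply: (proj1 a_loc); exact: IHs.
Qed.

Lemma prod_extend s i j k m v : supp_le m v ->
  (m + k * n <= `|i|)%N -> (m + k * n <= `|j|)%N ->
  fcoef (P (i :: rcons s j)) k v = fcoef (P s) k v.
Proof.
move=> hv hi hj; rewrite /P big_cons -cats1 big_cat big_seq1 coef_factorM /=.
rewrite coef_Mfactor -addrA -[RHS]addr0; congr (_ + _).
case: k hi hj => [|k] hi hj; first by rewrite addr0.
have hm : (m + n <= m + k.+1 * n)%N by rewrite leq_add2l leq_pmull.
rewrite ((proj2 a_loc) j m v) ?linear0 ?add0r //; last exact: leq_trans hj.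
apply: ((proj2 a_loc) i (m + k * n)%N); last by rewrite -addnA -mulSnr.
rewrite coef_Mfactor; apply: supp_leD; first exact: supp_le_prod.
case: k {hi hj hm} => [|k]; first exact: supp_le0.
rewrite mulSn addnA; apply: supp_le_prod; exact: (proj1 a_loc).
Qed.
End Stabilization.

Lemma mem_sumn (s : seq nat) x : x \in s -> (x <= sumn s)%N.
Proof.
elim: s => //= y s IHs; rewrite inE => /predU1P[->|/IHs]; first exact: leq_addr.
by move=> h; rewrite (leq_trans h) ?leq_addl.
Qed.

Lemma nth_le_sumn (s : seq nat) r : (nth 0 s r <= sumn s)%N.
Proof.
case: (ltnP r (size s)) => h; last by rewrite nth_default.
exact/mem_sumn/mem_nth.
Qed.

Lemma size_le_sumn (la : partition) : (size la <= sumn la)%N.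
Proof.
case: la => s /= /andP[_]; elim: s => //= x s IHs; rewrite inE negb_or.
by case: x => // x /andP[_ /IHs]; rewrite addSn ltnS => /leq_trans; apply; apply: leq_addl.
Qed.

Lemma sumn_nth (s : seq nat) m : (size s <= m)%N ->
  sumn s = (\sum_(0 <= r < m) nth 0 s r)%N.
Proof.
elim: s m => [|x s IHs] [|m] //= h.
- by rewrite big_nil.
- by rewrite big1 // => r _; rewrite nth_nil.
- by rewrite big_nat_recl //= -IHs.
Qed.

Lemma included_size (la mu : partition) : included la mu -> (size la <= size mu)%N.
Proof.
move=> h; rewrite leqNgt; apply/negP => lt.
have := h (size mu); rewrite [X in (_ <= X)%N]nth_default // leqn0 => /eqP e0.
have : (0%N \notin (la : seq nat)) by case: (la) => s /= /andP[].
by rewrite -e0 mem_nth.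
Qed.

Lemma ribbon_sumn (la mu : partition) : ribbon n la mu -> sumn mu = (sumn la + n)%N.
Proof.
case=> inc <- _ _; rewrite size_allpairs_dep [sumn (map _ _)]sumnE big_map.
have -> : iota 0 (size mu) = index_iota 0 (size mu) by rewrite /index_iota subn0.
rewrite (sumn_nth (leqnn (size mu))) (sumn_nth (included_size inc)) -big_split /=.
by apply: eq_bigr => r _; rewrite size_iota subnKC.
Qed.

Lemma ribbon_at_diag i (la mu : partition) : ribbon_at n i la mu -> (`|i| < sumn mu)%N.
Proof.
case=> _ [[r c] [] + _ <-]; rewrite mem_skew_boxes /diagonal /= => /andP[_ lt].
have hr : (r < size mu)%N.
  by rewrite ltnNge; apply: contraTN lt => /(nth_default 0) ->.
have := leq_trans lt (nth_le_sumn mu r); have := leq_trans hr (size_le_sumn mu).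
by lia.
Qed.

Lemma local_extend (f : int -> partition -> fock K) :
  (forall i (la : partition), supp_le (sumn la + n) (f i la)) ->
  (forall i (la : partition), (sumn la + n <= `|i|)%N -> f i la = 0) ->
  local_family (fun i => extend (f i)).
Proof.
move=> f1 f2; split=> i m v hv; rewrite extendE.
  apply: supp_le_sum => la /hv h; apply: supp_leZ.
  by apply: supp_leW (f1 _ _); rewrite leq_add2r.
move=> hi; rewrite big_seq big1 // => la /hv h.
by rewrite f2 ?scaler0 //; apply: leq_trans hi; rewrite leq_add2r.
Qed.

Lemma op_u_local : local_family (op_u q n).
Proof.
apply: local_extend => i la; case: pselect => [e|ne].
- case: (cid e) => mu /= [/ribbon_sumn h _]; apply: supp_leZ.
  by rewrite -h; exact: supp_le_ket.
- exact: supp_le0.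
- case: (cid e) => mu /= h; have := ribbon_at_diag h.
  by case: h => /ribbon_sumn -> _; rewrite ltnNge => /negP.
- by [].
Qed.

Lemma op_d_local : local_family (op_d q n).
Proof.
apply: local_extend => i la; case: pselect => [e|ne].
- case: (cid e) => nu /= [/ribbon_sumn h _]; apply: supp_leZ.
  by apply: supp_leW (@supp_le_ket _); rewrite h -addnA leq_addr.
- exact: supp_le0.
- case: (cid e) => nu /= h; have := ribbon_at_diag h.
  by move=> h1 h2; have := leq_trans h1 (leq_trans (leq_addr n _) h2); rewrite ltnn.
- by [].
Qed.

Lemma U_series_stable k la :
  eventually_eq (fun N => fcoef (U_part q n N) k (ket K la))
                (fcoef U_series k (ket K la)).
Proof.
suff h : eventually_eq (fun N => fcoef (U_part q n N) k (ket K la))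
    (fcoef (U_part q n (sumn la + k * n)) k (ket K la)).
  by rewrite [fcoef U_series _ _]extend_ket (stable_valueP h).
exists (sumn la + k * n)%N => N; elim: N => [|N IHN].
  by rewrite leqn0 => /eqP ->.
rewrite leq_eqVlt => /predU1P[-> //|]; rewrite ltnS => leN.
rewrite -IHN // /U_part windowS rev_cons rev_rcons.
by apply: (prod_extend op_u_local _ (@supp_le_ket la)); rewrite ?abszN; lia.
Qed.

Lemma D_series_stable k la :
  eventually_eq (fun N => fcoef (D_part q n N) k (ket K la))
                (fcoef D_series k (ket K la)).
Proof.
suff h : eventually_eq (fun N => fcoef (D_part q n N) k (ket K la))
    (fcoef (D_part q n (sumn la + k * n)) k (ket K la)).
  by rewrite [fcoef D_series _ _]extend_ket (stable_valueP h).
exists (sumn la + k * n)%N => N; elim: N => [|N IHN].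
  by rewrite leqn0 => /eqP ->.
rewrite leq_eqVlt => /predU1P[-> //|]; rewrite ltnS => leN.
rewrite -IHN // /D_part windowS.
by apply: (prod_extend op_d_local _ (@supp_le_ket la)); rewrite ?abszN; lia.
Qed.

End InfiniteProducts.

(* Main.v *)
(* Encode a partition by its edge sequence, a set of beads at the integers
   [la_r - r]. Adding an n-ribbon with head on diagonal [i] moves a bead from
   [i + 1 - n] to [i + 1], and its spin is the number of beads jumped over. On
   edge sequences one sees that [u_i] and [d_j] commute for [i <> j]. Let [T_i]
   be the diagonal operator multiplying a partition that has [m] beads in the
   [n] sites [i + 1 - n, ..., i] by [\prod_(k < m) (1 - q^(2k) x y)^-1]. A two by
   two matrix computation gives
     (1 + y d_i) T_(i+1) (1 + x u_i) = (1 + x u_i) T_i (1 + y d_i),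
   and hence, by induction on a window of diagonals [c, c + m),
     D T_(c+m) U = U T_c D
   for the products over that window. As the window exhausts the integers, the
   sites of [T_(c+m)] are eventually empty and those of [T_c] eventually full,
   so that these operators converge to [1] and to the scalar
   [\prod_(k < n) (1 - q^(2k) x y)^-1]. *)
Require Import Defs.
From mathcomp Require Import all_boot all_order all_algebra reals.
From mathcomp Require Import zify ring boolp freeg.
(* [finset.partition] would otherwise hide the type of integer partitions. *)
Import Defs.
Import Order.TTheory GRing.Theory Num.Theory.
Local Open Scope ring_scope.

Set Implicit Arguments.
Unset Strict Implicit.
Unset Printing Implicit Defensive.

(** * Partitions as sets of beads *)

Section Beads.
Implicit Types la mu : partition.

Lemma nth_partition_leq la r s : (r <= s)%N -> (nth 0 la s <= nth 0 la r)%N.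
Proof.
move=> rs; case: (ltnP s (size la)) => h; last by rewrite [X in (X <= _)%N]nth_default.
case: la h => p /= /andP[sp _] h.
have geq_trans : transitive geq by move=> a b c; rewrite /geq /= => ? ?; lia.
rewrite -/(geq _ _); apply: (sorted_leq_nth geq_trans leqnn 0%N sp) => //.
by rewrite inE; apply: leq_ltn_trans h.
Qed.

(** Induction on [m], peeling off [f 0]; once [f 0] vanishes, monotonicity leaves only the empty
    partition. *)
Lemma exists_partition (f : nat -> nat) (m : nat) :
  (forall r, (f r.+1 <= f r)%N) -> (forall r, (m <= r)%N -> f r = 0%N) ->
  exists la : partition, forall r, nth 0%N la r = f r.
Proof.
elim: m => [|m IHm] in f * => fS f0.
  have pnil : is_partition [::] by [].
  by exists (Partition pnil) => r; rewrite nth_nil f0.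
case: (posnP (f 0%N)) => [f00|f0gt].
  have pnil : is_partition [::] by [].
  exists (Partition pnil) => r; rewrite nth_nil; elim: r => // r.
  by have := fS r; lia.
have [la hla] := IHm (fun r => f r.+1) (fun r => fS r.+1) (fun r => f0 r.+1).
have p : is_partition (f 0%N :: la).
  case: la hla => p; rewrite /is_partition /= => /andP[sp n0] hla.
  rewrite inE negb_or n0 andbT; apply/andP; split; last by lia.
  rewrite path_min_sorted //; apply/allP => x /(nthP 0%N) [r _ <-].
  rewrite hla /geq /=; elim: r {x} => [|r IH]; first exact: fS.
  by apply: leq_trans IH.
by exists (Partition p) => -[|r] /=.
Qed.

Lemma partition_nth_inj la mu :
  (forall r, nth 0%N la r = nth 0%N mu r) -> la = mu.
Proof.
move=> h; apply/val_inj/(@eq_from_nth _ 0%N) => // /=.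
by apply/eqP; rewrite eqn_leq !included_size // => r; rewrite h.
Qed.

(* The position of the vertical boundary step of row r, for every r : nat: the
   empty rows contribute beads at all small enough integers. *)
Definition bead la r : int := (nth 0%N la r)%:Z - r%:Z.

Definition occ la (b : int) : bool := `[< exists r, bead la r = b >].

Lemma occP la b : reflect (exists r, bead la r = b) (occ la b).
Proof. exact: asboolP. Qed.

Lemma occ_bead la r : occ la (bead la r).
Proof. by apply/occP; exists r. Qed.

Lemma bead_lt la r s : (r < s)%N -> bead la s < bead la r.
Proof. by move=> rs; have := nth_partition_leq la (ltnW rs); rewrite /bead; lia. Qed.

Lemma bead_le la r s : (r <= s)%N -> bead la s <= bead la r.
Proof. by rewrite leq_eqVlt => /predU1P[-> //|/(bead_lt la)/ltW]. Qed.

Lemma bead_inj la : injective (bead la).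
Proof.
move=> r s e; case: (ltngtP r s) => // /(bead_lt la); by rewrite e ltxx.
Qed.

(** Beads strictly decrease along the rows, so listing the occupied sites in decreasing order
    recovers the partition. *)
Lemma occ_inj la mu : occ la =1 occ mu -> la = mu.
Proof.
move=> h.
have half (la' mu' : partition) r : occ la' =1 occ mu' ->
    (forall s, (s < r)%N -> bead la' s = bead mu' s) -> bead la' r <= bead mu' r.
  move=> h' e; have := occ_bead la' r; rewrite h' => /occP [s es].
  rewrite -es; case: (leqP r s) => [|sr]; first exact: bead_le.
  by have := bead_lt la' sr; rewrite (e _ sr) es ltxx.
apply: partition_nth_inj => r.
suff : bead la r = bead mu r by rewrite /bead; lia.
elim/ltn_ind: r => r IH; apply/eqP; rewrite eq_le !half // => s sr.
by rewrite IH.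
Qed.

Lemma occ_large la b : (sumn la)%:Z < b -> occ la b = false.
Proof.
move=> h; apply/negP => /occP [r e]; have := nth_le_sumn la r.
by move: e; rewrite /bead; lia.
Qed.

Lemma occ_small la b : b <= - (sumn la)%:Z -> occ la b.
Proof.
(* There are at most [sumn la] nonempty rows, so this row is empty and its bead is [b] itself. *)
move=> h; apply/occP; exists `|b|%N; rewrite /bead nth_default; first by lia.
by have := size_le_sumn la; lia.
Qed.

End Beads.

(** * Bead moves described row by row *)

Section RibbonShape.
Variable n : nat.
Hypothesis n_gt0 : (0 < n)%N.
Implicit Types la mu : partition.

(** The decreasing list of beads after the bead of row [r1] jumps [n] sites to the right: it is
    reinserted at row [r0], and each bead jumped over slips down one row. *)
Definition ribbon_rows la mu (r0 r1 : nat) : Prop :=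
  [/\ (r0 <= r1)%N,
      forall r, (r < r0)%N || (r1 < r)%N -> bead mu r = bead la r,
      forall r, (r0 <= r < r1)%N -> bead mu r.+1 = bead la r
    & bead mu r0 = bead la r1 + n%:Z].

(** Apart from row [r0] of [mu] and row [r1] of [la], the two lists carry the same beads;
    injectivity of [bead] gives the rest. *)
Lemma ribbon_rows_occ la mu r0 r1 : ribbon_rows la mu r0 r1 ->
  [/\ occ la (bead la r1), occ la (bead la r1 + n%:Z) = false
    & forall b, occ mu b = if b == bead la r1 + n%:Z then true
                           else if b == bead la r1 then false else occ la b].
Proof.
move=> [r01 out mid top].
have not_occ : occ la (bead la r1 + n%:Z) = false.
  apply/negP => /occP [s es]; rewrite -top in es.
  case: (boolP ((s < r0)%N || (r1 < s)%N)) => hs.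
    by have := out s hs; rewrite es => /bead_inj; lia.
  case: (eqVneq s r1) => [e1|ne].
    by move: es; rewrite e1 top; lia.
  have := mid s; rewrite es => h.
  have /bead_inj : bead mu s.+1 = bead mu r0 by apply: h; lia.
  by lia.
split=> //; first exact: occ_bead.
move=> b; case: eqP => [->|ne_top]; first by rewrite -top occ_bead.
case: eqP => [->|ne_bot].
  apply/negP => /occP [s es].
  case: (boolP ((s < r0)%N || (r1 < s)%N)) => hs.
    by have := out s hs; rewrite es => /bead_inj; lia.
  case: (eqVneq s r0) => [e1|ne].
    by move: es; rewrite e1 top; lia.
  case: s => [|s] in es hs ne *; first by lia.
  have h : bead mu s.+1 = bead la s by apply: mid; lia.
  by move: h; rewrite es => /bead_inj; lia.
apply/occP/occP => -[s es].
- case: (boolP ((s < r0)%N || (r1 < s)%N)) => hs.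
    by exists s; rewrite -out.
  case: (eqVneq s r0) => [e1|ne].
    by move: es; rewrite e1 top; lia.
  case: s => [|s] in es hs ne *; first by lia.
  by exists s; rewrite -mid //; lia.
- case: (boolP ((s < r0)%N || (r1 < s)%N)) => hs.
    by exists s; rewrite out.
  case: (eqVneq s r1) => [e1|ne].
    by move: es; rewrite e1; lia.
  by exists s.+1; rewrite mid //; lia.
Qed.

Lemma exists_ribbon_rows_up la b : occ la b -> ~~ occ la (b + n%:Z) ->
  exists mu r0 r1, ribbon_rows la mu r0 r1 /\ bead la r1 = b.
Proof.
move=> /occP [r1 e1] nocc.
have ex : exists r, bead la r < b + n%:Z by exists r1; rewrite e1; lia.
(* [r0] is the first row with its bead left of the target, the place where the moved bead is
   inserted. *)
case: (ex_minnP ex) => r0 h0 min0.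
have r01 : (r0 <= r1)%N by apply: min0; rewrite e1; lia.
have above r : (r < r0)%N -> b + n%:Z < bead la r.
  move=> rr0; case: (ltgtP (bead la r) (b + n%:Z)) => // [/min0|e]; first by lia.
  by move/negP: nocc; case; rewrite -e occ_bead.
(* A bead that keeps its position while slipping down one row yields a row one box longer. In row
   [r0], [h0] makes the argument of [absz] positive. *)
pose f r := if (r < r0)%N then nth 0%N la r
            else if r == r0 then absz (b + n%:Z + r0%:Z)
            else if (r <= r1)%N then (nth 0%N la r.-1).+1 else nth 0%N la r.
have [||mu hmu] := @exists_partition f (maxn r1.+1 (size la)).
- move=> r; have h1 := nth_partition_leq la (leqnSn r).
  have h2 := nth_partition_leq la (leq_pred r).
  have h3 := @above r; have h4 := nth_partition_leq la (leqnSn r.-1).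
  move: h0 e1 h3; rewrite /f /bead /= => h0 e1 h3.
  case: (ltngtP r.+1 r0) => c1; case: (ltngtP r r0) => c2; try lia.
  + by case: (leqP r.+1 r1) => c3; case: (leqP r r1) => c4; lia.
  rewrite -c2 in h0; case: (ltnP r r1) => c3; first by lia.
  have e : r = r1 by lia.
  by rewrite e in h1 *; lia.
- move=> r; rewrite geq_max => /andP[a1 a2]; rewrite /f.
  have -> : (r < r0)%N = false by lia.
  have -> : (r == r0) = false by lia.
  have -> : (r <= r1)%N = false by lia.
  by rewrite nth_default //; lia.
exists mu, r0, r1; split=> //; split=> // [r hr|r hr|].
- rewrite /bead hmu /f; case: ifP => // c1; case: eqP => [|c2]; first by lia.
  by have -> : (r <= r1)%N = false by lia.
- rewrite /bead hmu /f; have -> : (r.+1 < r0)%N = false by lia.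
  have -> : (r.+1 == r0) = false by lia.
  have -> : (r < r1)%N by lia.
  by rewrite /=; lia.
- by rewrite /bead hmu /f ltnn eqxx; move: h0 e1; rewrite /bead; lia.
Qed.

Lemma exists_ribbon_rows_down mu b : occ mu (b + n%:Z) -> ~~ occ mu b ->
  exists la r0 r1, ribbon_rows la mu r0 r1 /\ bead la r1 = b.
Proof.
move=> /occP [r0 e0] nocc.
have ex : exists r, bead mu r < b.
  (* No row is longer than [sumn mu], so the bead of this row lies left of [b]. *)
  exists (`|b|%N + sumn mu).+1.
  by have := nth_le_sumn mu (`|b|%N + sumn mu).+1; rewrite /bead; lia.
(* The vacant site [b] falls between the beads of rows [r1] and [r1.+1]; the first row left of [b]
   is not row 0, because [b + n%:Z] is occupied. *)
case: (ex_minnP ex) => -[|r1] h1 min1.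
  by have := bead_le mu (leq0n r0); rewrite e0; lia.
have r01 : (r0 <= r1)%N.
  rewrite leqNgt; apply/negP => c; have := bead_le mu c; rewrite e0; lia.
have above r : (r <= r1)%N -> b < bead mu r.
  move=> rr; case: (ltgtP (bead mu r) b) => // [/min1|e]; first by lia.
  by move/negP: nocc; case; rewrite -e occ_bead.
pose f r := if (r < r0)%N then nth 0%N mu r
            else if (r < r1)%N then (nth 0%N mu r.+1).-1
            else if r == r1 then absz (b + r1%:Z) else nth 0%N mu r.
have [||la hla] := @exists_partition f (maxn r1.+1 (size mu)).
- move=> r; have k1 := nth_partition_leq mu (leqnSn r).
  have k2 := nth_partition_leq mu (leqnSn r.+1).
  have k3 := @above r; have k4 := @above r.+1.
  move: h1 e0 k3 k4; rewrite /f /bead /= => h1 e0 k3 k4.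
  case: (ltngtP r.+1 r1) => c3; case: (ltngtP r r1) => c4;
    case: (ltnP r.+1 r0) => c1; case: (ltnP r r0) => c2; try lia.
  by rewrite c4 in k1 k2 *; lia.
- move=> r; rewrite geq_max => /andP[a1 a2]; rewrite /f.
  have -> : (r < r0)%N = false by lia.
  have -> : (r < r1)%N = false by lia.
  have -> : (r == r1) = false by lia.
  by rewrite nth_default //; lia.
have e1 : bead la r1 = b.
  rewrite /bead hla /f ltnn eqxx; have -> : (r1 < r0)%N = false by lia.
  by move: h1; rewrite /bead; lia.
exists la, r0, r1; split=> //; split=> // [r hr|r hr|].
- rewrite /bead hla /f; case: ifP => // c1; have -> : (r < r1)%N = false by lia.
  by have -> : (r == r1) = false by lia.
- rewrite /bead hla /f; have -> : (r < r0)%N = false by lia.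
  have -> : (r < r1)%N by lia.
  have := above r.+1; have := nth_partition_leq mu (leqnSn r1).
  have := @nth_partition_leq mu r.+1 r1.
  by move: h1; rewrite /bead; have := @above r1 (leqnn _); rewrite /bead; lia.
- by rewrite e0 e1.
Qed.

End RibbonShape.

(** * From the boxes of a ribbon to beads and back *)

Definition sites (a : int) (m : nat) : seq int := [seq a + k%:Z | k <- iota 0 m].

Lemma mem_sites a m b : (b \in sites a m) = (a <= b < a + m%:Z).
Proof.
apply/mapP/idP => [[k]|h]; first by rewrite mem_iota => ? ->; lia.
by exists `|b - a|%N; rewrite ?mem_iota; lia.
Qed.

Lemma uniq_sites a m : uniq (sites a m).
Proof. by rewrite map_inj_uniq ?iota_uniq // => x y; lia. Qed.

Definition beads_in (la : partition) (s : seq int) : nat := count (occ la) s.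

Section RibbonRows.
Variable n : nat.
Hypothesis n_gt0 : (0 < n)%N.
Implicit Types la mu : partition.

(** In each row, beads and row lengths have the same difference, and the shift by one row cancels
    all but the two extreme beads. This converts the size of a ribbon into the length of the
    jump. *)
Lemma sumn_sub_bead la mu r0 r1 : (r0 <= r1)%N ->
  (forall r, (r < r0)%N || (r1 < r)%N -> bead mu r = bead la r) ->
  (forall r, (r0 <= r < r1)%N -> bead mu r.+1 = bead la r) ->
  (sumn mu)%:Z - (sumn la)%:Z = bead mu r0 - bead la r1.
Proof.
move=> r01 out mid.
pose m := maxn r1.+1 (maxn (size la) (size mu)).
rewrite (@sumn_nth mu m) ?(@sumn_nth la m); try by rewrite /m; lia.
rewrite !(big_morph Posz PoszD (erefl 0%:Z)) -sumrB.
have -> : \sum_(0 <= r < m) ((nth 0%N mu r)%:Z - (nth 0%N la r)%:Z) =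
          \sum_(0 <= r < m) (bead mu r - bead la r).
  by apply: eq_bigr => r _; rewrite /bead; lia.
have hm : (r1.+1 <= m)%N by rewrite /m; lia.
rewrite (big_cat_nat (n := r0)) //=; last by lia.
rewrite big_nat_cond big1 ?add0r; last first.
  by move=> r; rewrite andbT => hr; rewrite out ?subrr //; lia.
rewrite (big_cat_nat (n := r1.+1)) //=; last by lia.
rewrite [X in _ + X]big_nat_cond [X in _ + X]big1 ?addr0; last first.
  by move=> r; rewrite andbT => hr; rewrite out ?subrr //; lia.
rewrite sumrB big_nat_recl // big_nat_recr //=.
have -> : \sum_(r0 <= r < r1) bead mu r.+1 = \sum_(r0 <= r < r1) bead la r.
  by apply: eq_big_nat => r hr; rewrite mid.
exact: addrKA.
Qed.

Lemma size_skew_boxes la mu : included la mu ->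
  sumn mu = (sumn la + size (skew_boxes la mu))%N.
Proof.
move=> inc; rewrite (sumn_nth (included_size inc)) (sumn_nth (leqnn (size mu))).
rewrite size_allpairs_dep sumnE big_map /index_iota subn0 -big_split /=.
by apply: eq_bigr => r _; rewrite size_iota subnKC.
Qed.

(** Adjacent boxes are at most one row apart, so the path steps vertically from row [k] to row
    [k.+1]. Connectedness is used in this form. *)
Lemma path_adjacent_cross k b p :
  path adjacent b p -> (b.1 <= k)%N -> (k < (last b p).1)%N ->
  exists c, (k, c) \in b :: p /\ (k.+1, c) \in b :: p.
Proof.
elim: p b => [|b' p IHp] b /=; first by move=> _; lia.
move=> /andP[adj hp] hb hl; case: (leqP b'.1 k) => hb'.
  have [c [h1 h2]] := IHp b' hp hb' hl.
  by exists c; rewrite !(in_cons b) h1 h2 !orbT.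
case: b b' {IHp hp hl} adj hb hb' => [r c] [r' c'].
rewrite /adjacent /= => adj hb hb'; exists c.
have [-> [-> ->]] : r = k /\ r' = k.+1 /\ c' = c by lia.
by rewrite !inE !eqxx orbT.
Qed.

Lemma ribbon_at_rows i la mu : ribbon_at n i la mu ->
  exists r0 r1, ribbon_rows n la mu r0 r1 /\ bead la r1 = i + 1 - n%:Z.
Proof.
move=> [[inc sz con no22] [[r0 c0] [in0 head0] diag0]].
have nonempty r : (nth 0 la r < nth 0 mu r)%N -> (r, nth 0%N la r) \in skew_boxes la mu.
  by rewrite mem_skew_boxes leqnn.
have ex : exists r, (nth 0 la r < nth 0 mu r)%N.
  by exists r0; move: in0; rewrite mem_skew_boxes; lia.
have bounded r : (nth 0 la r < nth 0 mu r)%N -> (r <= size mu)%N.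
  by move=> h; rewrite leqNgt; apply: contraTN h => /ltnW/(nth_default 0%N) ->.
case: (ex_maxnP ex bounded) => r1 h1 max1.
have r01 : (r0 <= r1)%N by have [] := head0 _ (nonempty _ h1).
have out r : (r < r0)%N || (r1 < r)%N -> bead mu r = bead la r.
  have := inc r; rewrite /bead leq_eqVlt => /predU1P[-> //|h] hr.
  by have [/= ? _] := head0 _ (nonempty _ h); have := max1 _ h; lia.
(* Connectedness gives rows [r] and [r.+1] a common column, and a second one would create a two by
   two square; hence row [r.+1] of [mu] is one box longer than row [r] of [la]. *)
have mid r : (r0 <= r < r1)%N -> bead mu r.+1 = bead la r.
  move=> /andP[hr0 hr1]; have [p [hp sub_p last_p]] := con _ _ in0 (nonempty _ h1).
  have [|c [in1 in2]] := path_adjacent_cross hp hr0; first by rewrite last_p.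
  have sub b : b \in (r0, c0) :: p -> b \in skew_boxes la mu.
    by rewrite inE => /predU1P[-> //|/sub_p].
  move: (sub _ in1) (sub _ in2) (no22 r (nth 0%N la r)).
  rewrite !mem_skew_boxes; have := nth_partition_leq la (leqnSn r).
  by have := nth_partition_leq mu (leqnSn r); rewrite /bead; lia.
(* The head is the last box of row [r0], and the bead is the step just after it; hence [i + 1] and
   not [i]. *)
have top : bead mu r0 = i + 1.
  have := head0 (r0, (nth 0%N mu r0).-1); move: in0 diag0.
  rewrite !mem_skew_boxes /diagonal /bead /= => in0 diag0 h.
  by have [_ ] := h ltac:(lia); lia.
exists r0, r1; have := sumn_sub_bead r01 out mid.
rewrite (size_skew_boxes inc) sz top => e; split; last by lia.
by split=> //; lia.
Qed.

Lemma connected_boxes_from b0 s : b0 \in s ->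
  (forall b, b \in s ->
    exists p, [/\ path adjacent b0 p, {subset p <= s} & last b0 p = b]) ->
  connected_boxes s.
Proof.
move=> in0 h b b' /h [p [hp sp lp]] /h [p' [hp' sp' lp']].
have last_rev : last b (rev (belast b0 p)) = b0.
  by case: p lp {hp sp} => [//|x p] /=; rewrite rev_cons last_rcons.
exists (rev (belast b0 p) ++ p'); split.
- rewrite cat_path last_rev hp' andbT -lp rev_path.
  rewrite (eq_path (e' := adjacent)) // => x y; rewrite /adjacent /=.
  by congr (_ || _); rewrite eq_sym orbC.
- move=> x; rewrite mem_cat mem_rev => /orP[/mem_belast|/sp' //].
  by rewrite inE => /predU1P[-> //|/sp].
- by rewrite last_cat last_rev.
Qed.

Lemma ribbon_rows_lt la mu r0 r1 r : ribbon_rows n la mu r0 r1 ->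
  (nth 0 la r < nth 0 mu r)%N = (r0 <= r <= r1)%N.
Proof.
move=> [r01 out mid top].
case: (boolP ((r < r0)%N || (r1 < r)%N)) => hr.
  by have := out r hr; rewrite /bead; lia.
have -> : (r0 <= r <= r1)%N by lia.
case: (eqVneq r r0) => [->|ne].
  case: (eqVneq r0 r1) => [e|ne].
    by move: top; rewrite -e /bead; lia.
  have := bead_lt mu (ltnSn r0); rewrite mid /bead; lia.
case: r => [|r] in hr ne *; first by lia.
have := mid r; have := nth_partition_leq la (leqnSn r); rewrite /bead; lia.
Qed.

(** Converse of [ribbon_at_rows]: consecutive rows overlap in a single column, which both forbids
    two by two squares and lets a path descend. *)
Lemma ribbon_rows_at la mu r0 r1 : ribbon_rows n la mu r0 r1 ->
  ribbon_at n (bead la r1 + n%:Z - 1) la mu.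
Proof.
move=> rows; have lt_rows r := ribbon_rows_lt r rows.
case: rows => r01 out mid top.
have inc : included la mu.
  move=> r; case: (boolP (r0 <= r <= r1)%N); first by rewrite -lt_rows => /ltnW.
  by move=> hr; have := out r ltac:(lia); rewrite /bead; lia.
have sz : size (skew_boxes la mu) = n.
  have := sumn_sub_bead r01 out mid; rewrite (size_skew_boxes inc) top; lia.
have in0 : (r0, (nth 0%N mu r0).-1) \in skew_boxes la mu.
  by rewrite mem_skew_boxes; have := lt_rows r0; lia.
split; last first.
  exists (r0, (nth 0%N mu r0).-1).
    split=> // -[r c] /=; rewrite mem_skew_boxes => h; have := lt_rows r.
    have := @nth_partition_leq mu r0 r; lia.
  by rewrite -top /diagonal /bead /=; have := lt_rows r0; lia.
split=> //; last first.
  move=> r c; rewrite !mem_skew_boxes; apply/negP => /and4P[h1 h2 h3 h4].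
  have := lt_rows r; have := lt_rows r.+1; have := mid r.
  by rewrite /bead; lia.
(* Each box is reached from the head by running left along a row and stepping down at its left end,
   which lies above the right end of the next row. *)
apply: (connected_boxes_from in0).
pose reach b := exists p, [/\ path adjacent (r0, (nth 0%N mu r0).-1) p,
  {subset p <= skew_boxes la mu} & last (r0, (nth 0%N mu r0).-1) p = b].
have step b b' : reach b -> adjacent b b' -> b' \in skew_boxes la mu -> reach b'.
  move=> [p [hp sp lp]] adj in'; exists (rcons p b'); split.
  - by rewrite rcons_path hp lp.
  - by move=> x; rewrite mem_rcons inE => /predU1P[-> //|/sp].
  - by rewrite last_rcons.
have row r c : reach (r, (nth 0%N mu r).-1) -> (r, c) \in skew_boxes la mu ->
    reach (r, c).
  rewrite mem_skew_boxes => reach_r.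
  have [m] := ubnP ((nth 0%N mu r).-1 - c)%N; elim: m c => // m IHm c lt_m hc.
  case: (eqVneq c (nth 0%N mu r).-1) => [-> //|ne].
  apply: (step (r, c.+1)); first by apply: IHm; lia.
    by rewrite /adjacent /= !eqxx.
  by rewrite mem_skew_boxes.
have row_end r : (r0 <= r <= r1)%N -> reach (r, (nth 0%N mu r).-1).
  elim: r => [|r IHr] hr.
    have e0 : r0 = 0%N by lia.
    by exists [::]; split=> //=; rewrite e0.
  case: (eqVneq r0 r.+1) => [<-|ne]; first by exists [::].
  have hr' : (r0 <= r <= r1)%N by lia.
  have e : (nth 0%N mu r.+1).-1 = nth 0%N la r.
    by have := mid r ltac:(lia); rewrite /bead; lia.
  rewrite e; apply: (step (r, nth 0%N la r)).
  - by apply: row; [exact: IHr|rewrite mem_skew_boxes leqnn lt_rows].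
  - by rewrite /adjacent /= !eqxx !orbT.
  - rewrite mem_skew_boxes -e; have := lt_rows r.+1; lia.
move=> [r c] h; apply: (row) => //; apply: row_end.
by rewrite -lt_rows; move: h; rewrite mem_skew_boxes; lia.
Qed.

(** Both sides equal [r1 - r0]: the beads jumped over are those of rows [r0] to [r1 - 1] of [la],
    and the [n.-1] sites leave out both ends of the jump. *)
Lemma ribbon_rows_spin la mu r0 r1 : ribbon_rows n la mu r0 r1 ->
  spin la mu = beads_in la (sites (bead la r1 + 1) n.-1).
Proof.
move=> rows; have lt_rows r := ribbon_rows_lt r rows.
case: rows => r01 out mid top.
have -> : spin la mu = (r1 - r0)%N.
  rewrite /spin; suff /perm_size -> :
    perm_eq (undup [seq b.1 | b <- skew_boxes la mu]) (iota r0 (r1 - r0).+1).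
    by rewrite size_iota.
  apply: uniq_perm (undup_uniq _) (iota_uniq _ _) _ => r.
  rewrite mem_undup mem_iota; apply/mapP/idP => [[[r' c] /= h ->]|h].
    by have := lt_rows r'; move: h; rewrite mem_skew_boxes; lia.
  exists (r, nth 0%N la r) => //; rewrite mem_skew_boxes leqnn lt_rows; lia.
rewrite /beads_in -size_filter -(size_iota r0 (r1 - r0)) -(size_map (bead la)).
apply/perm_size/uniq_perm.
- by rewrite map_inj_uniq ?iota_uniq //; apply: bead_inj.
- by rewrite filter_uniq ?uniq_sites.
move=> x; rewrite mem_filter mem_sites; apply/mapP/andP.
  move=> [r]; rewrite mem_iota => hr ->; split; first exact: occ_bead.
  have := @bead_lt la r r1 ltac:(lia); have := @bead_lt mu r0 r.+1 ltac:(lia).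
  by rewrite mid ?top; lia.
move=> [/occP [r <-] h]; exists r => //; rewrite mem_iota.
have h1 : (r < r1)%N by rewrite ltnNge; apply/negP => /(bead_le la); lia.
have h0 : (r0 <= r)%N.
  rewrite leqNgt; apply/negP => hr; have := bead_lt mu hr; rewrite top out ?hr //; lia.
by lia.
Qed.

End RibbonRows.

(** * Moves on one diagonal and on two different diagonals *)

Section BeadMoves.
Variable n : nat.
Hypothesis n_gt0 : (0 < n)%N.
Implicit Types la mu nu : partition.

Definition addable (i : int) la := occ la (i + 1 - n%:Z) && ~~ occ la (i + 1).
Definition removable (i : int) la := occ la (i + 1) && ~~ occ la (i + 1 - n%:Z).
Definition inner_beads (i : int) la := beads_in la (sites (i + 1 - n%:Z + 1) n.-1).

(** Together with [addable_ribbon] and [removable_ribbon], this is the dictionary between ribbons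
    and bead moves. *)
Lemma ribbon_at_move i la mu : ribbon_at n i la mu ->
  [/\ addable i la, removable i mu, spin la mu = inner_beads i la
    & forall b, occ mu b = (b == i + 1) || (occ la b && (b != i + 1 - n%:Z))].
Proof.
move=> /(ribbon_at_rows n_gt0) [r0 [r1 [rows e]]].
have [occ1 occ0 upd] := ribbon_rows_occ n_gt0 rows.
have top : bead la r1 + n%:Z = i + 1 by rewrite e; lia.
rewrite top e in occ0 occ1 upd.
split.
- by rewrite /addable occ1 occ0.
- rewrite /removable !upd eqxx eqxx; case: eqP => //; lia.
- by rewrite (ribbon_rows_spin n_gt0 rows) e.
- by move=> b; rewrite upd; case: eqP => //= _; case: eqP; rewrite ?andbT ?andbF.
Qed.

Lemma ribbon_at_inj_r i la mu mu' :
  ribbon_at n i la mu -> ribbon_at n i la mu' -> mu = mu'.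
Proof.
move=> /ribbon_at_move[_ _ _ h] /ribbon_at_move[_ _ _ h'].
by apply: occ_inj => b; rewrite h h'.
Qed.

(** Away from the two ends of the move [la] agrees with [mu], and at the ends [addable] prescribes
    it. *)
Lemma ribbon_at_inj_l i la la' mu :
  ribbon_at n i la mu -> ribbon_at n i la' mu -> la = la'.
Proof.
move=> /ribbon_at_move[h1 _ _ h] /ribbon_at_move[h1' _ _ h'].
apply: occ_inj => b; move: (h b) (h' b) h1 h1'; rewrite /addable.
case: (eqVneq b (i + 1)) => [->|_ -> /=].
  by move=> _ _ /andP[_ /negPf->] /andP[_ /negPf->].
case: (eqVneq b (i + 1 - n%:Z)) => [->|_]; rewrite ?andbT // => _.
by move=> /andP[-> _] /andP[-> _].
Qed.

Lemma addable_ribbon i la : addable i la -> exists mu, ribbon_at n i la mu.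
Proof.
move=> /andP[h1 h0].
have [|mu [r0 [r1 [rows e]]]] := exists_ribbon_rows_up n_gt0 h1.
  by have -> : i + 1 - n%:Z + n%:Z = i + 1 by lia.
exists mu; have := ribbon_rows_at n_gt0 rows.
by have -> : bead la r1 + n%:Z - 1 = i by lia.
Qed.

Lemma removable_ribbon i mu : removable i mu -> exists la, ribbon_at n i la mu.
Proof.
move=> /andP[h1 h0].
have e0 : i + 1 - n%:Z + n%:Z = i + 1 by lia.
rewrite -e0 in h1; have [la [r0 [r1 [rows e]]]] := exists_ribbon_rows_down n_gt0 h1 h0.
exists la; have := ribbon_rows_at n_gt0 rows.
by have -> : bead la r1 + n%:Z - 1 = i by lia.
Qed.

(** One bead leaves and one arrives; the sums on both sides avoid truncated subtraction. *)
Lemma beads_in_move i la mu (s : seq int) : ribbon_at n i la mu -> uniq s ->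
  (beads_in mu s + ((i + 1 - n%:Z)%R \in s) = beads_in la s + ((i + 1)%R \in s))%N.
Proof.
move=> /ribbon_at_move[/andP[h1 h0] _ _ h] us; rewrite -!count_uniq_mem //.
rewrite /beads_in; elim: s {us} => [//|x s IHs] /=; rewrite h.
rewrite addnACA IHs [RHS]addnACA; congr (_ + _)%N.
case: (eqVneq x (i + 1)) => [->|_] /=; first by rewrite (negPf h0); case: eqP; lia.
by case: (eqVneq x (i + 1 - n%:Z)) => [->|_]; rewrite ?h1 ?andbF ?andbT ?addn0.
Qed.

Lemma inner_beads_move i la mu : ribbon_at n i la mu ->
  inner_beads i mu = inner_beads i la.
Proof.
move=> h; have := beads_in_move h (uniq_sites (i + 1 - n%:Z + 1) n.-1).
by rewrite !mem_sites /inner_beads; lia.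
Qed.

(** The [n]-site windows for [i] and [i + 1] share the inner sites of the move on diagonal [i]; the
    first adds its source, the second (next lemma) its target. *)
Lemma beads_in_sites_l i la :
  beads_in la (sites (i + 1 - n%:Z) n) = (occ la (i + 1 - n%:Z)%R + inner_beads i la)%N.
Proof.
rewrite /beads_in /inner_beads /beads_in /sites.
case: n n_gt0 => // m _; rewrite -[m.+1]add1n iotaD map_cat count_cat /= !addr0 addn0.
congr (_ + _)%N; rewrite (iotaDl 1 0) -map_comp; congr count.
by apply: eq_map => k /=; lia.
Qed.

Lemma beads_in_sites_r i la :
  beads_in la (sites (i + 1 + 1 - n%:Z) n) = (inner_beads i la + occ la (i + 1)%R)%N.
Proof.
rewrite /beads_in /inner_beads /beads_in /sites.
case: n n_gt0 => // m _; rewrite -[in iota _ _]addn1 iotaD map_cat count_cat /= addn0.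
congr (_ + _)%N; last by congr (occ la _); lia.
by congr count; apply: eq_map => k /=; lia.
Qed.

(* The intervals jumped over have the same length, so an end of one lies inside
   the other exactly when the opposite end of the other lies inside the first. *)
Lemma inner_beads_square i j ka la mu nu : i != j ->
  ribbon_at n i la mu -> ribbon_at n j nu mu ->
  ribbon_at n j ka la -> ribbon_at n i ka nu ->
  (inner_beads i la + inner_beads j nu = inner_beads j ka + inner_beads i ka)%N.
Proof.
move=> ij Rlm Rnm Rkl Rkn.
have := beads_in_move Rkl (uniq_sites (i + 1 - n%:Z + 1) n.-1).
have := beads_in_move Rkn (uniq_sites (j + 1 - n%:Z + 1) n.-1).
by rewrite !mem_sites /inner_beads; lia.
Qed.

(** The two moves have distinct sources and distinct targets, and no source is a target since
    sources are occupied in [ka] and targets empty; so the moves are independent. *)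
Lemma ribbon_square_up i j ka la nu : i != j ->
  ribbon_at n j ka la -> ribbon_at n i ka nu ->
  exists2 mu, ribbon_at n i la mu & ribbon_at n j nu mu.
Proof.
move=> ij Rkl Rkn.
have top_ne : ((i + 1 == j + 1) = false) * ((j + 1 == i + 1) = false) by split; lia.
have bot_ne : ((i + 1 - n%:Z == j + 1 - n%:Z) = false) *
              ((j + 1 - n%:Z == i + 1 - n%:Z) = false) by split; lia.
have [/andP[kj' kj] _ _ ul] := ribbon_at_move Rkl.
have [/andP[ki' ki] _ _ un] := ribbon_at_move Rkn.
have excl b : ~~ ((b == i + 1) && (b == j + 1 - n%:Z)) /\
              ~~ ((b == j + 1) && (b == i + 1 - n%:Z)).
  split; apply/negP => /andP[/eqP-> /eqP e].
  - by rewrite e kj' in ki.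
  - by rewrite e ki' in kj.
have /addable_ribbon [mu Rlm] : addable i la.
  by rewrite /addable !ul top_ne bot_ne ki' (negPf ki) orbT.
have /addable_ribbon [mu' Rnm] : addable j nu.
  by rewrite /addable !un top_ne bot_ne kj' (negPf kj) orbT.
exists mu => //; suff -> : mu = mu' by [].
have [_ _ _ um] := ribbon_at_move Rlm; have [_ _ _ um'] := ribbon_at_move Rnm.
apply: occ_inj => b; rewrite um ul um' un; have [] := excl b.
by do 4!case: (b == _); case: (occ ka b).
Qed.

Lemma ribbon_square_down i j la mu nu : i != j ->
  ribbon_at n i la mu -> ribbon_at n j nu mu ->
  exists2 ka, ribbon_at n j ka la & ribbon_at n i ka nu.
Proof.
move=> ij Rlm Rnm.
have [/andP[li' li] /andP[mi mi'] _ um] := ribbon_at_move Rlm.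
have [/andP[nj' nj] /andP[mj mj'] _ un] := ribbon_at_move Rnm.
(* The exclusion is now read off [mu], where targets are occupied and sources empty. *)
have excl b : [/\ ~~ ((b == i + 1) && (b == j + 1)),
    ~~ ((b == i + 1 - n%:Z) && (b == j + 1 - n%:Z)),
    ~~ ((b == i + 1) && (b == j + 1 - n%:Z)) &
    ~~ ((b == j + 1) && (b == i + 1 - n%:Z))].
  split; try lia; apply/negP => /andP[/eqP-> /eqP e].
  - by rewrite e (negPf mj') in mi.
  - by rewrite e (negPf mi') in mj.
have /removable_ribbon [ka Rkl] : removable j la.
  case: (excl (j + 1)) (excl (j + 1 - n%:Z)) mj mj'; rewrite /removable !um !eqxx /=.
  move=> + _ _ + [_ + + _]; rewrite !andbT => /negPf-> /negPf-> /negPf-> /negPf-> /=.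
  by rewrite !andbT => -> ->.
have [/andP[kj' kj] _ _ ul] := ribbon_at_move Rkl.
have /addable_ribbon [nu' Rkn] : addable i ka.
  case: (excl (i + 1)) (excl (i + 1 - n%:Z)) li li'; rewrite /addable !ul !eqxx /=.
  move=> /negPf-> _ /negPf-> _ [_ /negPf-> _]; rewrite andbT => /negPf-> /=.
  by rewrite !andbT => -> ->.
exists ka => //; suff -> : nu = nu' by [].
have [_ _ _ un'] := ribbon_at_move Rkn; apply: occ_inj => b.
(* The move on [j] overwrites both of its ends, so [mu] says nothing about [nu] there; these values
   come from [addable]. *)
have at_j' : (b == j + 1 - n%:Z) ==> occ nu b && occ ka b.
  by apply/implyP => /eqP->; rewrite nj'.
have at_j : (b == j + 1) ==> ~~ occ nu b && ~~ occ ka b.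
  by apply/implyP => /eqP->; rewrite nj.
move: at_j at_j' (um b); have [] := excl b; rewrite un ul un'.
by do 4!case: (b == _); case: (occ ka b); case: (occ nu b).
Qed.

End BeadMoves.

(** * Coefficients of power series in two variables *)

Section FpsCoefficients.
Variable A : pzRingType.
Implicit Types (s : fps (fps A)) (c : A).

Lemma varxC s : varx * s = s * varx.
Proof. exact: fpsXC. Qed.

Lemma varyC s : vary * s = s * vary.
Proof. by apply: fpsP => a; rewrite fcoefCM fcoefMC fpsXC. Qed.

Lemma coef_const2M c s a b : fcoef (fcoef (const2 c * s) a) b = c * fcoef (fcoef s a) b.
Proof. by rewrite !fcoefCM. Qed.

Lemma coef_Mconst2 c s a b : fcoef (fcoef (s * const2 c) a) b = fcoef (fcoef s a) b * c.
Proof. by rewrite !fcoefMC. Qed.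

Lemma coef_varxyM s a b : fcoef (fcoef (varx * vary * s) a) b =
  match a, b with a'.+1, b'.+1 => fcoef (fcoef s a') b' | _, _ => 0 end.
Proof.
rewrite -mulrA fcoefXM; case: a => // a.
by rewrite fcoefCM fcoefXM.
Qed.

Lemma in_xM (s t : fps A) : in_x (s * t) = in_x s * in_x t.
Proof.
apply: fpsP => a; apply: fpsP => b; rewrite fcoefM /=.
transitivity (\sum_(i < a.+1) fcoef (fpsC (fcoef s i) * fpsC (fcoef t (a - i))) b).
  case: eqP => [->|b0]; first by apply: eq_bigr => i _; rewrite fcoefCM.
  by rewrite big1 // => i _; rewrite fcoefCM /=; case: eqP => // _; rewrite mulr0.
by elim/big_rec2: _ => // i x y _ ->.
Qed.

Lemma in_yM (s t : fps A) : in_y (s * t) = in_y s * in_y t.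
Proof.
by apply: fpsP => a; rewrite fcoefCM /=; case: eqP; rewrite ?mulr0.
Qed.

Lemma in_x1 : in_x (1 : fps A) = 1.
Proof. by apply: fpsP => -[|a]; apply: fpsP => -[|b]. Qed.

Lemma in_x_factor c : in_x (1 + fpsX A * fpsC c) = 1 + varx * const2 c.
Proof.
apply: fpsP => a; rewrite fcoefD fcoefXM.
rewrite -[LHS]/(fpsC (fcoef (1 + fpsX A * fpsC c) a)) fcoefD fcoefXM.
by case: a => [|[|a]]; apply: fpsP => -[|b]; rewrite /= ?addr0 ?add0r.
Qed.

Lemma in_y_factor c : in_y (1 + fpsX A * fpsC c) = 1 + vary * const2 c.
Proof.
apply: fpsP => a; rewrite fcoefD fcoefCM /=.
by case: a => [//|a]; rewrite mulr0 addr0.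
Qed.

End FpsCoefficients.

(** * Linearity of operators *)

Section EndoLinearity.
Variables (K : fieldType) (V : lmodType K).
Implicit Types (f : endo V).

Lemma endoZE f c v : f (c *: v) = c *: f v.
Proof. exact: linearZ. Qed.

Lemma endo0r f : f 0 = 0.
Proof. exact: linear0. Qed.

Lemma endoDr f v w : f (v + w) = f v + f w.
Proof. exact: linearD. Qed.

Lemma endo_sumr f (I : Type) (r : seq I) (F : I -> V) :
  f (\sum_(i <- r) F i) = \sum_(i <- r) f (F i).
Proof. exact: linear_sum. Qed.

End EndoLinearity.

(** * Commutation on different diagonals and the relation on a single one *)

Section LocalRelation.
Variables (K : fieldType) (q : K) (n : nat).
Hypothesis n_gt0 : (0 < n)%N.
Implicit Types la mu nu : partition.
Local Notation u := (op_u q n).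
Local Notation d := (op_d q n).

Lemma endo_ket_eq (f g : endo (fock K)) : (forall la, f (ket K la) = g (ket K la)) -> f = g.
Proof.
move=> h; apply: endoP => v; rewrite [v]fockE !endo_sumr.
by apply: eq_bigr => la _; rewrite !endoZE h.
Qed.

Lemma op_u_ket i la mu : ribbon_at n i la mu ->
  u i (ket K la) = q ^+ inner_beads n i la *: ket K mu.
Proof.
move=> h; rewrite extend_ket; case: pselect => [e|[]]; last by exists mu.
case: (cid e) => mu' /= h'; have [_ _ -> _] := ribbon_at_move n_gt0 h'.
by rewrite (ribbon_at_inj_r n_gt0 h h').
Qed.

Lemma op_u_ket0 i la : ~~ addable n i la -> u i (ket K la) = 0.
Proof.
move=> h; rewrite extend_ket; case: pselect => // -[mu h'].
by have [al _ _ _] := ribbon_at_move n_gt0 h'; rewrite al in h.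
Qed.

Lemma op_d_ket i nu la : ribbon_at n i nu la ->
  d i (ket K la) = q ^+ inner_beads n i nu *: ket K nu.
Proof.
move=> h; rewrite extend_ket; case: pselect => [e|[]]; last by exists nu.
case: (cid e) => nu' /= h'; have [_ _ -> _] := ribbon_at_move n_gt0 h'.
by rewrite (ribbon_at_inj_l n_gt0 h h').
Qed.

Lemma op_d_ket0 i la : ~~ removable n i la -> d i (ket K la) = 0.
Proof.
move=> h; rewrite extend_ket; case: pselect => // -[mu h'].
by have [_ al _ _] := ribbon_at_move n_gt0 h'; rewrite al in h.
Qed.

(** Completing squares of ribbons shows that both sides vanish together; otherwise
    [inner_beads_square] matches the powers of [q]. *)
Lemma op_ud_comm i j : i != j -> d j * u i = u i * d j.
Proof.
move=> ij; apply: endo_ket_eq => la; rewrite !endoME.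
have [al|nal] := boolP (addable n i la); last rewrite (op_u_ket0 nal) endo0r.
  have [mu Rlm] := addable_ribbon n_gt0 al.
  have [rm|nrm] := boolP (removable n j mu).
    have [nu Rnm] := removable_ribbon n_gt0 rm.
    have [ka Rkl Rkn] := ribbon_square_down n_gt0 ij Rlm Rnm.
    rewrite (op_u_ket Rlm) (op_d_ket Rkl) !endoZE (op_d_ket Rnm) (op_u_ket Rkn).
    by rewrite !scalerA -!exprD (inner_beads_square n_gt0 ij Rlm Rnm Rkl Rkn).
  rewrite (op_u_ket Rlm) endoZE (op_d_ket0 nrm) scaler0.
  have [rl|nrl] := boolP (removable n j la); last by rewrite (op_d_ket0 nrl) endo0r.
  have [ka Rkl] := removable_ribbon n_gt0 rl; rewrite (op_d_ket Rkl) endoZE.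
  have [ak|nak] := boolP (addable n i ka); last by rewrite (op_u_ket0 nak) scaler0.
  have [nu Rkn] := addable_ribbon n_gt0 ak.
  (* A nonzero right-hand side completes to a square with top corner [mu], contradicting [nrm]. *)
  have [mu' Rlm' Rnm'] := ribbon_square_up n_gt0 ij Rkl Rkn.
  have [_ rm' _ _] := ribbon_at_move n_gt0 Rnm'.
  by rewrite (ribbon_at_inj_r n_gt0 Rlm Rlm') rm' in nrm.
have [rl|nrl] := boolP (removable n j la); last by rewrite (op_d_ket0 nrl) endo0r.
have [ka Rkl] := removable_ribbon n_gt0 rl; rewrite (op_d_ket Rkl) endoZE.
have [ak|nak] := boolP (addable n i ka); last by rewrite (op_u_ket0 nak) scaler0.
have [nu Rkn] := addable_ribbon n_gt0 ak.
have [mu' Rlm' _] := ribbon_square_up n_gt0 ij Rkl Rkn.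
by have [al' _ _ _] := ribbon_at_move n_gt0 Rlm'; rewrite al' in nal.
Qed.

Definition cauchy_factor (m : nat) : fps (fps K) :=
  \prod_(0 <= i < m) (1 - const2 (q ^+ (2 * i)) * varx * vary)^-1.

(** The last factor is cleared from its denominator, leaving a recursion on coefficients without
    inverses. *)
Lemma cauchy_factorS m :
  cauchy_factor m.+1 = cauchy_factor m +
    varx * vary * (const2 (q ^+ (2 * m)) * cauchy_factor m.+1).
Proof.
have <- : (1 - const2 (q ^+ (2 * m)) * varx * vary) * cauchy_factor m.+1 = cauchy_factor m.
  rewrite /cauchy_factor big_nat_recr //= mulrCA mulrV ?mulr1 //.
  exact: one_sub_cxy_unit.
by ring.
Qed.

Definition diag_op (f : partition -> fps (fps K)) : fps (fps (endo (fock K))) :=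
  Fps (fun a => Fps (fun b => extend (fun la => fcoef (fcoef (f la) a) b *: ket K la))).

Lemma coef_diag_op f a b la :
  fcoef (fcoef (diag_op f) a) b (ket K la) = fcoef (fcoef (f la) a) b *: ket K la.
Proof. exact: extend_ket. Qed.

(** This is [T_i]; its window contains the source of the move on diagonal [i] but not the target. *)
Definition site_op (i : int) :=
  diag_op (fun la => cauchy_factor (beads_in la (sites (i + 1 - n%:Z) n))).

(** The diagonal entries of the two by two computation: adding the ribbon takes a bead out of the
    window for [i] and brings one into the window for [i + 1]. *)
Lemma coef_site_op_ket i a b la mu : ribbon_at n i la mu ->
  (fcoef (fcoef (site_op i) a) b (ket K la) =
     fcoef (fcoef (cauchy_factor (inner_beads n i la).+1) a) b *: ket K la) *
  (fcoef (fcoef (site_op i) a) b (ket K mu) =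
     fcoef (fcoef (cauchy_factor (inner_beads n i la)) a) b *: ket K mu) *
  (fcoef (fcoef (site_op (i + 1)) a) b (ket K la) =
     fcoef (fcoef (cauchy_factor (inner_beads n i la)) a) b *: ket K la) *
  (fcoef (fcoef (site_op (i + 1)) a) b (ket K mu) =
     fcoef (fcoef (cauchy_factor (inner_beads n i la).+1) a) b *: ket K mu).
Proof.
move=> R; have [/andP[l1 l0] /andP[m1 m0] _ _] := ribbon_at_move n_gt0 R.
rewrite !coef_diag_op !(beads_in_sites_r n_gt0) !(beads_in_sites_l n_gt0).
by rewrite (inner_beads_move n_gt0 R) l1 m1 (negPf l0) (negPf m0) !add1n addn0 addn1.
Qed.

(** After expansion, [site_u] matches the terms with [varx] alone, [site_d] those with [vary] alone,
    and [site_ud] the remaining ones, which mix because [site_op] itself involves [x y]. *)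
Lemma local_relation i :
  (1 + vary * const2 (d i)) * site_op (i + 1) * (1 + varx * const2 (u i)) =
  (1 + varx * const2 (u i)) * site_op i * (1 + vary * const2 (d i)).
Proof.
have site_d : const2 (d i) * site_op (i + 1) = site_op i * const2 (d i).
  apply: fpsP => a; apply: fpsP => b; apply: endo_ket_eq => la.
  rewrite coef_const2M coef_Mconst2 !endoME.
  have [/(removable_ribbon n_gt0) [nu R]|nr] := boolP (removable n i la).
    rewrite (coef_site_op_ket a b R) endoZE (op_d_ket R) endoZE.
    by rewrite (coef_site_op_ket a b R) !scalerA mulrC.
  by rewrite coef_diag_op endoZE (op_d_ket0 nr) !endo0r scaler0.
have site_u : site_op (i + 1) * const2 (u i) = const2 (u i) * site_op i.
  apply: fpsP => a; apply: fpsP => b; apply: endo_ket_eq => la.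
  rewrite coef_const2M coef_Mconst2 !endoME.
  have [/(addable_ribbon n_gt0) [mu R]|nr] := boolP (addable n i la).
    rewrite (coef_site_op_ket a b R) endoZE (op_u_ket R) endoZE.
    by rewrite (coef_site_op_ket a b R) !scalerA mulrC.
  by rewrite (op_u_ket0 nr) endo0r coef_diag_op endoZE (op_u_ket0 nr) scaler0.
have site_ud :
    site_op (i + 1) + varx * vary * (const2 (d i) * site_op (i + 1) * const2 (u i)) =
    site_op i + varx * vary * (const2 (u i) * site_op i * const2 (d i)).
  apply: fpsP => a; apply: fpsP => b; apply: endo_ket_eq => la.
  rewrite !(fcoefD, endoDE) !coef_varxyM.
  (* The power [q ^+ (2 * m)] is split in two because [u i] and [d i] each contribute [q ^+ m] when
     jumping over [m] beads. *)
  have coef_step m : fcoef (fcoef (cauchy_factor m.+1) a) b =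
      fcoef (fcoef (cauchy_factor m) a) b +
      match a, b with
      | a'.+1, b'.+1 => q ^+ m * (q ^+ m * fcoef (fcoef (cauchy_factor m.+1) a') b')
      | _, _ => 0
      end.
    rewrite {1}cauchy_factorS !fcoefD coef_varxyM; congr (_ + _).
    by case: a b => [|a] [|b] //; rewrite coef_const2M mulrA -exprD addnn mul2n.
  have [/(addable_ribbon n_gt0) [mu R]|na] := boolP (addable n i la).
    rewrite !(coef_site_op_ket a b R) coef_step scalerDl -!addrA; congr (_ + _).
    have nr : ~~ removable n i la.
      have [/andP[l1 l0] _ _ _] := ribbon_at_move n_gt0 R.
      by rewrite /removable (negPf l0).
    case: a b {coef_step} => [|a] [|b]; rewrite ?scale0r ?addr0 //.
    rewrite !(coef_Mconst2, coef_const2M) !endoME (op_d_ket0 nr) !endo0r addr0.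
    rewrite (op_u_ket R) !endoZE (coef_site_op_ket a b R) endoZE (op_d_ket R).
    by rewrite !scalerA; congr (_ *: _); ring.
  have [/(removable_ribbon n_gt0) [nu R]|nr] := boolP (removable n i la).
    rewrite !(coef_site_op_ket a b R) coef_step scalerDl -!addrA; congr (_ + _).
    case: a b {coef_step} => [|a] [|b]; rewrite ?scale0r ?addr0 //.
    rewrite !(coef_Mconst2, coef_const2M) !endoME (op_u_ket0 na) !endo0r addr0.
    rewrite (op_d_ket R) !endoZE (coef_site_op_ket a b R) endoZE (op_u_ket R).
    by rewrite !scalerA; congr (_ *: _); ring.
  rewrite !coef_diag_op (beads_in_sites_r n_gt0) (beads_in_sites_l n_gt0).
  (* With neither move possible, source and target are both occupied or both empty, so the two
     windows contain equally many beads. *)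
  have -> : (inner_beads n i la + occ la (i + 1)%R =
             occ la (i + 1 - n%:Z)%R + inner_beads n i la)%N.
    by rewrite addnC; congr (_ + _)%N; move: na nr; rewrite /addable /removable;
       do 2!case: (occ la _).
  congr (_ + _); case: a b {coef_step} => [|a] [|b] //.
  rewrite !(coef_Mconst2, coef_const2M) !endoME (op_u_ket0 na) (op_d_ket0 nr).
  by rewrite !endo0r.
have varx2 (s t : fps (fps (endo (fock K)))) : s * (varx * t) = varx * (s * t).
  by rewrite !mulrA varxC.
have vary2 (s t : fps (fps (endo (fock K)))) : s * (vary * t) = vary * (s * t).
  by rewrite !mulrA varyC.
rewrite !mulrDl !mulrDr !mul1r !mulr1 -!mulrA !varx2 !vary2.
move: site_ud; rewrite -!mulrA !vary2 => site_ud.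
rewrite [X in _ + X = _]addrC addrACA [X in _ = _ + X]addrC [RHS]addrACA site_ud.
by congr (_ + _); rewrite site_u site_d addrC.
Qed.

End LocalRelation.

(** * The identity over a finite window of diagonals *)

Section WindowIdentity.
Variables (K : fieldType) (q : K) (n : nat).
Hypothesis n_gt0 : (0 < n)%N.
Local Notation u := (op_u q n).
Local Notation d := (op_d q n).

Lemma in_x_prod (a : int -> endo (fock K)) s :
  in_x (\prod_(i <- s) linear_factor a i) = \prod_(i <- s) (1 + varx * const2 (a i)).
Proof.
elim: s => [|i s IHs]; first by rewrite !big_nil in_x1.
by rewrite !big_cons in_xM IHs in_x_factor.
Qed.

Lemma in_y_prod (a : int -> endo (fock K)) s :
  in_y (\prod_(i <- s) linear_factor a i) = \prod_(i <- s) (1 + vary * const2 (a i)).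
Proof.
elim: s => [|i s IHs]; first by rewrite !big_nil.
by rewrite !big_cons in_yM IHs in_y_factor.
Qed.

Lemma factor_comm i j : i != j ->
  GRing.comm (1 + vary * const2 (d j)) (1 + varx * const2 (u i)).
Proof.
move=> ij; apply: commrD; first exact: commr1.
apply: commrM; first by rewrite /GRing.comm varxC.
apply/commr_sym/commrD; first exact: commr1.
apply: commrM; first by rewrite /GRing.comm varyC.
apply: fpsP => a; apply: fpsP => b; rewrite !coef_const2M.
by case: a => [|a]; case: b => [|b]; rewrite /= ?mulr0 // op_ud_comm.
Qed.

(** Induction peels off the smallest diagonal [c], whose factors stand outermost on the left side.
    After the induction hypothesis at [c + 1], they commute past the other products and meet around
    [site_op q n (c + 1)], where [local_relation] applies. *)
Lemma window_identity c m :
  in_y (\prod_(i <- sites c m) linear_factor d i) * site_op q n (c + m%:Z) *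
    in_x (\prod_(i <- rev (sites c m)) linear_factor u i) =
  in_x (\prod_(i <- rev (sites c m)) linear_factor u i) * site_op q n c *
    in_y (\prod_(i <- sites c m) linear_factor d i).
Proof.
rewrite in_x_prod in_y_prod.
elim: m c => [|m IHm] c; first by rewrite /sites !big_nil !mul1r !mulr1 addr0.
have -> : sites c m.+1 = c :: sites (c + 1) m.
  rewrite /sites -[m.+1]add1n iotaD map_cat /= addr0; congr (_ :: _).
  by rewrite (iotaDl 1 0) -map_comp; apply: eq_map => k /=; lia.
rewrite rev_cons -cats1 big_cons big_cat big_seq1 /=.
have -> : c + m.+1%:Z = c + 1 + m%:Z by lia.
move: (IHm (c + 1)).
set D := \prod_(i <- _) _; set U := \prod_(i <- rev _) _ => IH.
have comm_U : GRing.comm (1 + vary * const2 (d c)) U.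
  rewrite /U big_seq; apply: commr_prod => i; rewrite mem_rev mem_sites => hi.
  by apply: factor_comm; lia.
have comm_D : GRing.comm (1 + varx * const2 (u c)) D.
  rewrite /D big_seq; apply: commr_prod => i; rewrite mem_sites => hi.
  by apply/commr_sym/factor_comm; lia.
rewrite -!mulrA (mulrA D) (mulrA (D * _)) IH.
rewrite -!mulrA -comm_D !mulrA comm_U -!mulrA; congr (_ * _).
by rewrite !mulrA local_relation.
Qed.

End WindowIdentity.

(** * Pointwise stable limits of operators and of power series *)

Section PointwiseLimit.
Variable K : fieldType.
Local Notation F := (fock K).

(* Every vector is eventually mapped to its limit: the topology in which the
   infinite products converge, for which multiplication is continuous. *)
Definition endo_lim (f : nat -> endo F) (g : endo F) : Prop :=
  forall v, eventually_eq (fun N => f N v) (g v).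

Lemma eventually_eqD (V : zmodType) (s t : nat -> V) x y :
  eventually_eq s x -> eventually_eq t y -> eventually_eq (fun N => s N + t N) (x + y).
Proof.
move=> [M hM] [M' hM']; exists (maxn M M') => N.
by rewrite geq_max => /andP[/hM-> /hM'->].
Qed.

Lemma endo_limD f f' g g' : endo_lim f g -> endo_lim f' g' ->
  endo_lim (fun N => f N + f' N) (g + g').
Proof. by move=> hf hf' v; apply: eventually_eqD. Qed.

Lemma endo_limM f f' g g' : endo_lim f g -> endo_lim f' g' ->
  endo_lim (fun N => f N * f' N) (g * g').
Proof.
(* Once [f' N v] has settled at [g' v], only the convergence of [f] at that single vector
   matters. *)
move=> hf hf' v; have [M hM] := hf' v; have [M' hM'] := hf (g' v).
exists (maxn M M') => N; rewrite geq_max => /andP[leM leM'].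
by rewrite !endoME hM // hM'.
Qed.

Lemma endo_lim_sum (I : Type) (r : seq I) (f : I -> nat -> endo F) (g : I -> endo F) :
  (forall i, endo_lim (f i) (g i)) ->
  endo_lim (fun N => \sum_(i <- r) f i N) (\sum_(i <- r) g i).
Proof.
move=> h; elim: r => [|i r IHr] v.
  by exists 0%N => N _; rewrite !big_nil.
have [M hM] := endo_limD (h i) IHr v.
by exists M => N /hM; rewrite !big_cons.
Qed.

(** A vector is a finite combination of kets, so finitely many thresholds suffice. *)
Lemma endo_lim_ket (f : nat -> endo F) (g : endo F) :
  (forall la, eventually_eq (fun N => f N (ket K la)) (g (ket K la))) -> endo_lim f g.
Proof.
move=> h v; rewrite [v]fockE.
elim: (dom v) => [|la r IHr].
  by exists 0%N => N _; rewrite big_nil !endo0r.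
have [M hM] := h la; have [M' hM'] := IHr; exists (maxn M M') => N.
by rewrite geq_max big_cons !endoDr !endoZE => /andP[/hM-> /hM'->].
Qed.

Definition fps2_lim (s : nat -> fps (fps (endo F))) (t : fps (fps (endo F))) : Prop :=
  forall a b, endo_lim (fun N => fcoef (fcoef (s N) a) b) (fcoef (fcoef t a) b).

Lemma fps2_lim_unique s t t' : fps2_lim s t -> fps2_lim s t' -> t = t'.
Proof.
move=> h h'; apply: fpsP => a; apply: fpsP => b; apply: endoP => v.
exact: eventually_eq_unique (h a b v) (h' a b v).
Qed.

Lemma fcoef_sum (A : pzRingType) (I : Type) (r : seq I) (f : I -> fps A) k :
  fcoef (\sum_(i <- r) f i) k = \sum_(i <- r) fcoef (f i) k.
Proof. by elim/big_rec2: _ => // i x y _ <-. Qed.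

(** Each coefficient of a product is a finite sum of products of coefficients. *)
Lemma fps2_limM s s' t t' : fps2_lim s t -> fps2_lim s' t' ->
  fps2_lim (fun N => s N * s' N) (t * t').
Proof.
move=> h h' a b.
have coefM (x y : fps (fps (endo F))) : fcoef (fcoef (x * y) a) b =
    \sum_(i < a.+1) \sum_(j < b.+1) fcoef (fcoef x i) j * fcoef (fcoef y (a - i)) (b - j).
  by rewrite fcoefM fcoef_sum; apply: eq_bigr => i _; rewrite fcoefM.
rewrite coefM => v.
have [M hM] := endo_lim_sum (index_enum _) (fun i : 'I_a.+1 =>
  endo_lim_sum (index_enum _) (fun j : 'I_b.+1 =>
    endo_limM (h i j) (h' (a - i)%N (b - j)%N))) v.
by exists M => N /hM <-; rewrite coefM.
Qed.

End PointwiseLimit.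

(** * Passage to the limit over all diagonals *)

Section CauchyIdentity.
Variables (K : fieldType) (q : K) (n : nat).
Hypothesis n_gt0 : (0 < n)%N.

Lemma window_sites N : window N = sites (- N%:Z) N.*2.+1.
Proof. by apply: eq_map => j; rewrite addrC. Qed.

Lemma in_x_U_lim : fps2_lim (fun N => in_x (U_part q n N)) (in_x (U_series q n)).
Proof.
move=> a b; apply: endo_lim_ket => la /=.
have [M hM] := U_series_stable q n a la.
by exists M => N /hM; case: eqP.
Qed.

Lemma in_y_D_lim : fps2_lim (fun N => in_y (D_part q n N)) (in_y (D_series q n)).
Proof.
move=> a b; apply: endo_lim_ket => la /=.
have [M hM] := D_series_stable q n b la.
by exists M => N /hM; case: eqP.
Qed.

Lemma site_op_lim (c : nat -> int) m :
  (forall la, exists M, forall N, (M <= N)%N ->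
     beads_in la (sites (c N + 1 - n%:Z) n) = m) ->
  fps2_lim (fun N => site_op q n (c N)) (scalar_fps2 (fock K) (cauchy_factor q m)).
Proof.
move=> h a b; apply: endo_lim_ket => la; have [M hM] := h la.
by exists M => N leN; rewrite coef_diag_op hM.
Qed.

Lemma site_op_lim_right :
  fps2_lim (fun N => site_op q n N.+1%:Z) 1.
Proof.
suff <- : scalar_fps2 (fock K) (cauchy_factor q 0) = 1.
  (* From this threshold on, the whole window lies to the right of [sumn la], where no bead sits. *)
  apply: site_op_lim => la; exists (sumn la + n)%N => N leN.
  apply/eqP; rewrite /beads_in -leqn0 leqNgt -has_count; apply/hasPn => b.
  by rewrite mem_sites => hb; rewrite occ_large //; lia.
rewrite /cauchy_factor big_nil; apply: fpsP => -[|a]; apply: fpsP => -[|b] //=;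
  by apply: endoP => v /=; rewrite ?scale1r ?scale0r.
Qed.

Lemma site_op_lim_left :
  fps2_lim (fun N => site_op q n (- N%:Z)) (scalar_fps2 (fock K) (cauchy_factor q n)).
Proof.
(* The window ends at [- N%:Z], so from this threshold on all of its [n] sites are occupied. *)
apply: site_op_lim => la; exists (sumn la) => N leN.
have -> : beads_in la (sites (- N%:Z + 1 - n%:Z) n) =
          size (sites (- N%:Z + 1 - n%:Z) n).
  apply/eqP; rewrite -all_count; apply/allP => b.
  by rewrite mem_sites => hb; apply: occ_small; lia.
by rewrite size_map size_iota.
Qed.

Lemma scalar_fps2_comm (s : fps (fps K)) (t : fps (endo (fock K))) :
  in_y t * scalar_fps2 (fock K) s = scalar_fps2 (fock K) s * in_y t.
Proof.
apply: fpsP => a; rewrite fcoefCM fcoefMC; apply: fpsP => b.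
rewrite !fcoefM fps_mul_rev; apply: eq_bigr => i _.
by apply: endoP => v /=; rewrite endoZE.
Qed.

Lemma ribbon_cauchy_identity :
  in_x (U_series q n) * in_y (D_series q n) *
    scalar_fps2 (fock K) (cauchy_factor q n) =
  in_y (D_series q n) * in_x (U_series q n).
Proof.
(* The scalar goes between [U] and [D], and a factor 1 between [D] and [U]: the places where the two
   site operators converge to them. *)
rewrite -mulrA scalar_fps2_comm mulrA -[in_y _ in RHS]mulr1.
apply: (@fps2_lim_unique _ (fun N => in_x (U_part q n N) * site_op q n (- N%:Z) *
                                     in_y (D_part q n N))).
  exact: fps2_limM (fps2_limM in_x_U_lim site_op_lim_left) in_y_D_lim.
have lim_eq : (fun N => in_x (U_part q n N) * site_op q n (- N%:Z) *
                            in_y (D_part q n N)) =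
  (fun N => in_y (D_part q n N) * site_op q n N.+1%:Z * in_x (U_part q n N)).
  (* The window starts at [- N%:Z] and has [N.*2.+1] diagonals, so the other site operator has index
     [N.+1%:Z]. *)
  apply/funext => N; rewrite /U_part /D_part window_sites -window_identity //.
  by congr (_ * site_op _ _ _ * _); lia.
rewrite lim_eq; exact: fps2_limM (fps2_limM in_y_D_lim site_op_lim_right) in_x_U_lim.
Qed.

End CauchyIdentity.

Theorem theorem5p2 (R : realType) (n : nat) (hn : (1 <= n)%N) :
  let q := qvar R in
  let U := in_x (U_series q n) in
  let D := in_y (D_series q n) in
  U * D * scalar_fps2 (fock (Cq R))
            (\prod_(0 <= i < n) (1 - const2 (q ^+ (2 * i)) * varx * vary)^-1)
  = D * U.
Proof. exact: ribbon_cauchy_identity. Qed.
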